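(* Let $I\subset\mathbb R$ be a compact interval with interior $I^\circ$, and let $\psi\in C^\infty(I)$ be real valued with $\psi(t)-t\psi'(t)\neq 0$ for all $t\in I$. Let $b\in C_0^\infty(\mathbb R^2)$ with $\operatorname{supp}(b)\subset I^\circ\times\mathbb R$ and $b=0$ near the origin. For $\Phi\in C_0^\infty(\mathbb R)$ with $\operatorname{supp}(\Phi)\subset[-1,1]$ and $\delta\in(0,1/2]$ put $$\phi^{(\delta)}(\xi)=b(\xi)\,\Phi\big(\delta^{-1}(\xi_2-\psi(\xi_1))\big),\qquad \eta=\mathscr F^{-1}(\phi^{(\delta)}).$$ Then $$\|g_\eta(f)\|_2\le C\delta^{1/2}\|\Phi\|_\infty\|f\|_2\qquad\text{for all } f\in\mathscr S(\mathbb R^2),$$ where the constant $C$ is independent of $\Phi$, $\delta$ and $f$.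
   Context: $\mathscr S(\mathbb R^2)$ is the Schwartz space and $\|\cdot\|_p$ is the $L^p(\mathbb R^2)$ norm. The Fourier transform is $\mathscr F(f)(\xi)=\hat f(\xi)=\int_{\mathbb R^2}f(x)e^{-2\pi i\langle x,\xi\rangle}\,dx$, and $\mathscr F^{-1}$ is its inverse. The Littlewood-Paley function of $f$ associated with $h$ is $$g_h(f)(x)=\Big(\int_0^\infty|h_t*f(x)|^2\,\frac{dt}t\Big)^{1/2},\qquad h_t(x)=t^{-2}h(t^{-1}x).$$ *)

(* Defs.v *)
From HB Require Import structures.
From mathcomp Require Import all_boot all_order all_algebra.
From mathcomp Require Import complex.
From mathcomp Require Import all_classical all_reals all_analysis.

Set Implicit Arguments.
Unset Strict Implicit.
Unset Printing Implicit Defensive.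

Import Order.TTheory GRing.Theory Num.Theory.
Import numFieldNormedType.Exports.

Local Open Scope classical_set_scope.
Local Open Scope ring_scope.
Local Open Scope complex_scope.

Local Notation normc := ComplexField.Normc.normc.

(* R^2 is R * R with the product Lebesgue measure; functions take values in
   the complex numbers R[i], and a complex-valued function is differentiated
   and integrated through its real and imaginary parts. *)

Section SmoothFunctions.
Context {R : realType}.

(* Derivative relative to A; one-sided at the endpoints of an interval. *)
Definition derive_within (A : set R) (f : R -> R) (x : R) : R :=
  lim ((fun y => (f y - f x) / (y - x)) @ within A x^').

Definition derivable_within (A : set R) (f : R -> R) (x : R) : Prop :=
  cvg ((fun y => (f y - f x) / (y - x)) @ within A x^').

(* C^oo on A up to the boundary; only the values of f on A matter. *)
Definition smooth_within (A : set R) (f : R -> R) : Prop :=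
  forall n x, A x -> derivable_within A (iter n (derive_within A) f) x.

Definition smooth1 (f : R -> R[i]) : Prop :=
  forall n x, derivable (derive1n n (fun y => complex.Re (f y))) x 1 /\
              derivable (derive1n n (fun y => complex.Im (f y))) x 1.

Definition axis (j : bool) : R * R := if j then (0, 1) else (1, 0).

(* Iterated partial derivative along a word of coordinate directions:
   false is the first coordinate, true the second. *)
Fixpoint partials (s : seq bool) (f : R * R -> R) : R * R -> R :=
  if s is j :: s' then fun x => 'D_(axis j) (partials s' f) x else f.

Definition real_smooth2 (f : R * R -> R) : Prop :=
  forall s, continuous (partials s f) /\
            forall x j, derivable (partials s f) x (axis j).

Definition smooth2 (f : R * R -> R[i]) : Prop :=
  real_smooth2 (fun x => complex.Re (f x)) /\ real_smooth2 (fun x => complex.Im (f x)).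

Definition cpartials (s : seq bool) (f : R * R -> R[i]) (x : R * R) : R[i] :=
  partials s (fun y => complex.Re (f y)) x +i* partials s (fun y => complex.Im (f y)) x.

Definition supp {T : topologicalType} (f : T -> R[i]) : set T :=
  closure [set x | f x != 0].

Definition C0oo1 (f : R -> R[i]) : Prop := smooth1 f /\ compact (supp f).

Definition C0oo2 (f : R * R -> R[i]) : Prop := smooth2 f /\ compact (supp f).

Definition schwartz (f : R * R -> R[i]) : Prop :=
  smooth2 f /\
  forall (m n : nat) (s : seq bool), exists M : R, forall x : R * R,
    `|x.1 ^+ m * x.2 ^+ n| * normc (cpartials s f x) <= M.

End SmoothFunctions.

Notation leb2 R := (@lebesgue_measure R \x @lebesgue_measure R)%E.

Section FourierLittlewoodPaley.
Context {R : realType}.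

Definition cintegral2 (F : R * R -> R[i]) : R[i] :=
  (\int[leb2 R]_x complex.Re (F x)) +i* (\int[leb2 R]_x complex.Im (F x)).

Definition dot (x y : R * R) : R := x.1 * y.1 + x.2 * y.2.

Definition expi (theta : R) : R[i] := cos theta +i* sin theta.

(* Inverse of the Fourier transform with kernel exp (- 2 pi i <x, xi>). *)
Definition inv_fourier (h : R * R -> R[i]) (x : R * R) : R[i] :=
  cintegral2 (fun xi => h xi * expi (2 * pi * dot x xi)).

Definition dilate (h : R * R -> R[i]) (t : R) (x : R * R) : R[i] :=
  (t ^- 2)%:C * h (t^-1 *: x).

Definition convolution (h f : R * R -> R[i]) (x : R * R) : R[i] :=
  cintegral2 (fun y => h (x - y) * f y).

Definition LP_function (h f : R * R -> R[i]) (x : R * R) : \bar R :=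
  ((\int[lebesgue_measure]_(t in `]0%R, +oo[)
     (normc (convolution (dilate h t) f x) ^+ 2 / t)%:E) `^ 2^-1)%E.

Definition cLnorm {d : measure_display} {T : measurableType d}
    (mu : {measure set T -> \bar R}) (p : \bar R) (f : T -> R[i]) : \bar R :=
  ('N[mu]_p[(fun x => (normc (f x))%:E)])%E.

Definition phi_delta (b : R * R -> R[i]) (Phi : R -> R[i]) (psi : R -> R)
    (delta : R) (xi : R * R) : R[i] :=
  b xi * Phi (delta^-1 * (xi.2 - psi xi.1)).

End FourierLittlewoodPaley.

(* Main.v *)
Require Import Defs.
From HB Require Import structures.
From mathcomp Require Import all_boot all_order all_algebra.
From mathcomp Require Import complex.
From mathcomp Require Import all_classical all_reals all_analysis.
From mathcomp Require Import measurable_realfun ess_sup_inf ring lra.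

Set Implicit Arguments.
Unset Strict Implicit.
Unset Printing Implicit Defensive.

Import Order.TTheory GRing.Theory Num.Theory.
Import numFieldNormedType.Exports.

Local Open Scope classical_set_scope.
Local Open Scope ring_scope.
Local Open Scope complex_scope.

(** In frequency, convolution with the dilated kernel eta_t is multiplication
by phi (t .), where phi is the multiplier phi_delta. If the Fourier transform
is bounded on L2, the square of the norm of the square function of f is
therefore at most a constant times the integral over w of
  |fhat (w)|^2 * (integral over t > 0 of |phi (t w)|^2 dt / t),
and the theorem follows once the inner integral is O(delta S^2) uniformly in w,
where S is the supremum norm of Phi.

The inner integral concerns a ray {t w}. The multiplier lives where t w is
within delta of the graph of psi, and, with tau = 1 / t, this says that
tau * psi (w1 / tau) is within delta * tau of w2. The derivative in tau of this
function is psi (s) - s * psi' (s) at s = w1 / tau, which is bounded away from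
0: geometrically, rays cross the graph transversally. Hence two admissible
scales t1 and t2 satisfy c |t2 - t1| <= delta (t1 + t2) (slope_separation,
scaling_times_close). Since b is supported in an annulus, the admissible scales
are comparable with 1 / |w|, so they fill an interval of length O(delta / |w|)
on which dt / t has mass O(delta) (multiplier_bound).

The L2 input is the inequality |ghat|_2 <= A |g|_2 for integrable g, with an
absolute constant A. It is obtained by TT-star: with a window of width N
inserted in the frequency integral, the energy of ghat is a quadratic form in g
whose kernel is the transform of the window (TTstar). That kernel is dominated
by a product of Cauchy kernels (norm_integral_window_cos), whose integral does
not depend on N, so Schur's test gives a uniform bound, and N tends to infinity
(bessel). The inequality is used twice: for f itself, and at each scale t for
the frequency piece phi (xi) fhat (xi / t) of which the convolution is the
transform (convolution_dilateE). A change of variables then moves the scale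
from fhat to phi (energy_at_scale, square_function_bound). *)

(** * Fubini for dominated real integrands *)

Section ProductSigmaFinite.
Context d1 d2 (X : measurableType d1) (Y : measurableType d2) (R : realType).
Variables (m1 : {sigma_finite_measure set X -> \bar R})
          (m2 : {sigma_finite_measure set Y -> \bar R}).

Lemma product_sigma_finite : sigma_finite setT (m1 \x m2)%E.
Proof.
have /sigma_finiteP[F [UF ndF mF]] := sigma_finiteT m1.
have /sigma_finiteP[G [UG ndG mG]] := sigma_finiteT m2.
exists (fun n => F n `*` G n).
  apply/seteqP; split=> // -[x y] _.
  have : [set: X] x by [].
  have : [set: Y] y by [].
  rewrite UF UG => -[j _ Gj] [i _ Fi]; exists (maxn i j) => //; split => /=.
    by move: (ndF _ _ (leq_maxl i j)) => /subsetPset; exact.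
  by move: (ndG _ _ (leq_maxr i j)) => /subsetPset; exact.
move=> n; have [mFn Fn] := mF n; have [mGn Gn] := mG n.
split; first exact: measurableX.
by rewrite product_measure1E// lte_mul_pinfty// ge0_fin_numE.
Qed.

End ProductSigmaFinite.

Section DominatedFubini.
Context d1 d2 (X : measurableType d1) (Y : measurableType d2) (R : realType).
Variables (m1 : {sigma_finite_measure set X -> \bar R})
          (m2 : {sigma_finite_measure set Y -> \bar R}).

(** The real integral is the finite part of the difference between the
integrals of the positive and of the negative part, and each of these is
measurable in the parameter by Tonelli's theorem. *)
Lemma measurable_Rintegral_param (F : X * Y -> R) : measurable_fun setT F ->
  measurable_fun setT (fun x => \int[m2]_y F (x, y)).
Proof.
move=> mF; pose E : X * Y -> \bar R := EFin \o F.
have mE : measurable_fun setT E by exact/measurable_EFinP.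
apply: measurableT_comp; first exact: fine_measurable.
rewrite (_ : (fun x => _) = (fun x => \int[m2]_y E^\+ (x, y))
    \- (fun x => \int[m2]_y E^\- (x, y)))%E; last first.
  apply/funext => x; rewrite [LHS]integralE.
  by congr (_ - _)%E; apply: eq_integral => y _; rewrite ?funeposE ?funenegE.
apply: emeasurable_funB.
  apply: measurable_fun_fubini_tonelli_F; last by move=> ?; exact: funepos_ge0.
  exact: measurable_funepos.
apply: measurable_fun_fubini_tonelli_F; last by move=> ?; exact: funeneg_ge0.
exact: measurable_funeneg.
Qed.

Variables (F : X * Y -> R) (al : X -> R) (be : Y -> R).
Hypothesis mF : measurable_fun setT F.
Hypothesis ial : m1.-integrable setT (EFin \o al).
Hypothesis ibe : m2.-integrable setT (EFin \o be).
Hypothesis domF : forall x y, `|F (x, y)| <= `|al x| * `|be y|.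

Lemma dominated_integrable_section1 x : m2.-integrable setT (fun y => (F (x, y))%:E).
Proof.
apply: (@le_integrable _ _ _ _ _ measurableT _ (fun y => (al x * be y)%:E)).
- apply/measurable_EFinP; exact: (measurableT_comp mF).
- by move=> y _; rewrite /= lee_fin normrM.
- exact: (integrableZl measurableT _ ibe).
Qed.

Lemma dominated_integrable_section2 y : m1.-integrable setT (fun x => (F (x, y))%:E).
Proof.
apply: (@le_integrable _ _ _ _ _ measurableT _ (fun x => (be y * al x)%:E)).
- apply/measurable_EFinP; exact: (measurableT_comp mF).
- by move=> x _; rewrite /= lee_fin normrM mulrC.
- exact: (integrableZl measurableT _ ial).
Qed.

(** Tonelli reduces this to the product of the integrals of the two dominating
factors. *)
Lemma dominated_integrable_prod : (m1 \x m2)%E.-integrable setT (EFin \o F).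
Proof.
apply/integrable12ltyP; first exact/measurable_EFinP.
pose I2 := (\int[m2]_y `|(be y)%:E|)%E.
have I2fin : I2 \is a fin_num.
  by rewrite ge0_fin_numE ?integral_ge0//; case/integrableP: ibe.
apply: (@le_lt_trans _ _ (\int[m1]_x (`|(al x)%:E| * I2))%E); last first.
  rewrite ge0_integralZr//; last 2 first.
    by apply: measurableT_comp => //; exact: measurable_int ial.
    exact: integral_ge0.
  rewrite lte_mul_pinfty ?integral_ge0//; last by rewrite -ge0_fin_numE// integral_ge0.
  by rewrite ge0_fin_numE ?integral_ge0//; case/integrableP: ial.
pose E (z : X * Y) := `|(F z)%:E|%E.
have mEF : measurable_fun setT E.
  by apply: measurableT_comp => //; exact/measurable_EFinP.
apply: ge0_le_integral => //.
- by move=> x _; exact: integral_ge0.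
- by apply: (@measurable_fun_fubini_tonelli_F _ _ _ _ _ m2 E) => // z; exact: abse_ge0.
- apply: emeasurable_funM => //.
  apply: measurableT_comp => //; exact: measurable_int ial.
move=> x _; rewrite -ge0_integralZl//; last first.
  apply: measurableT_comp => //; exact: measurable_int ibe.
apply: ge0_le_integral => //.
- apply: (measurableT_comp mEF); exact: pair1_measurable.
- apply: emeasurable_funM => //.
  apply: measurableT_comp => //; exact: measurable_int ibe.
- by move=> y _; rewrite /= lee_fin.
Qed.

(** Domination by a product makes every section integrable, not just almost
every one, so that Fubini's theorem descends from extended to real integrals
without exceptional points. *)
Lemma dominated_Rintegral_swap :
  \int[m1]_x \int[m2]_y F (x, y) = \int[m2]_y \int[m1]_x F (x, y).
Proof.
have := Fubini dominated_integrable_prod.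
under eq_integral => x _.
  rewrite -(@fineK _ (integral _ _ _)); last first.
    exact: integrable_fin_num (dominated_integrable_section1 x).
  over.
under [in RHS]eq_integral => y _.
  rewrite -(@fineK _ (integral _ _ _)); last first.
    exact: integrable_fin_num (dominated_integrable_section2 y).
  over.
by move=> h; congr fine.
Qed.

End DominatedFubini.

(** * A window and its cosine transform *)

Section Derivation.
Context {R : realType}.
Implicit Types (f g : R -> R) (x a b c : R).

Lemma is_derive_addf f g x a b : is_derive x 1 f a -> is_derive x 1 g b ->
  is_derive x 1 (fun s => f s + g s) (a + b).
Proof. by move=> df dg; exact: is_deriveD. Qed.

Lemma is_derive_mulf f g x a b : is_derive x 1 f a -> is_derive x 1 g b ->
  is_derive x 1 (fun s => f s * g s) (f x * b + g x * a).
Proof. by move=> df dg; exact: is_deriveM. Qed.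

Lemma is_derive_mull g c x b : is_derive x 1 g b ->
  is_derive x 1 (fun s => c * g s) (c * b).
Proof. by move=> dg; exact: (is_deriveZ c). Qed.

Lemma is_derive_cos_mul c x : is_derive x 1 (fun s => cos (c * s)) (- (c * sin (c * x))).
Proof.
have dg : is_derive x 1 (fun s => c * s) (c * 1) := is_derive_mull c (is_derive_id x (1 : R)).
apply: (is_derive_eq (is_derive1_comp (is_derive_cos _) dg)); ring.
Qed.

Lemma is_derive_sin_mul c x : is_derive x 1 (fun s => sin (c * s)) (c * cos (c * x)).
Proof.
have dg : is_derive x 1 (fun s => c * s) (c * 1) := is_derive_mull c (is_derive_id x (1 : R)).
apply: (is_derive_eq (is_derive1_comp (is_derive_sin _) dg)); ring.
Qed.

Lemma is_derive_continuous f x a : is_derive x 1 f a -> {for x, continuous f}.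
Proof. by move=> df; apply/differentiable_continuous/derivable1_diffP. Qed.

Lemma Rintegral_FTC (f F : R -> R) (a b : R) : a < b -> continuous f ->
  (forall x, is_derive x 1 F (f x)) ->
  \int[lebesgue_measure]_(x in `[a, b]) f x = F b - F a.
Proof.
move=> ab cf dF; have cF x := is_derive_continuous (dF x).
rewrite /Rintegral (@continuous_FTC2 _ _ F)//.
- exact: continuous_subspaceT.
- split.
  + by move=> x _; exact: ex_derive.
  + apply: cvg_at_right_filter; exact: cF.
  + apply: cvg_at_left_filter; exact: cF.
- by move=> x _; rewrite derive1E; exact: derive_val.
Qed.

End Derivation.

Section ParabolicWindow.
Context {R : realType}.
Local Notation mu := (@lebesgue_measure R).
Implicit Types (N a s x : R).

(** The parabola vanishes at the two ends of its support, so that two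
integrations by parts give its transform quadratic decay, and the transform is
integrable. The windows increase to 1 with N. *)
Definition window N : R -> R := (fun s => 1 - (s / N) ^+ 2) \_ `[- N, N].

Lemma window_ge0 N s : 0 < N -> 0 <= window N s.
Proof.
move=> N0; rewrite /window patchE; case: ifPn => // /[!inE]/= /[!in_itv]/= /andP[sl su].
rewrite subr_ge0 -[leRHS](expr1n _ 2) -ler_sqrt ?sqr_ge0// ?expr1n ?ltr01//.
by rewrite sqrtr1 sqrtr_sqr normf_div (gtr0_norm N0) ler_pdivrMr// mul1r ler_norml sl su.
Qed.

Lemma window_le1 N s : 0 < N -> `|window N s| <= 1.
Proof.
move=> N0; rewrite ger0_norm ?window_ge0// /window patchE; case: ifPn => // _.
by rewrite lerBlDr lerDl sqr_ge0.
Qed.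

Lemma measurable_window N : measurable_fun [set: R] (window N).
Proof.
apply/measurable_restrict => //; apply: measurable_funTS.
apply: continuous_measurable_fun => x.
by apply: cvgB; [exact: cvg_cst|apply: cvgM; apply: cvgM => //; exact: cvg_cst].
Qed.

Lemma le_window (N M s : R) : 0 < N -> N <= M -> window N s <= window M s.
Proof.
move=> N0 NM; have M0 : 0 < M by exact: lt_le_trans NM.
rewrite {1}/window patchE; case: ifPn => [|_]; last exact: window_ge0.
rewrite inE/= in_itv/= => /andP[sl su].
have sM : s \in `[- M, M]%classic.
  by rewrite inE/= in_itv/= (le_trans _ sl) ?lerN2//= (le_trans su).
rewrite /window patchE sM lerD2l lerN2 !exprMn ler_wpM2l ?sqr_ge0//.
by rewrite lerXn2r ?nnegrE ?invr_ge0 ?(ltW N0) ?(ltW M0)// lef_pV2 ?posrE.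
Qed.

Lemma cvg_window s : window n.+1%:R s @[n --> \oo] --> (1 : R).
Proof.
have lim1 : 1 - (s * harmonic n) ^+ 2 @[n --> \oo] --> (1 : R).
  have e : (1 : R) = 1 - (s * 0) * (s * 0) by ring.
  rewrite [X in _ --> X]e.
  apply: cvgB; first exact: cvg_cst.
  by apply: cvgM; (apply: cvgM; [exact: cvg_cst|exact: cvg_harmonic]).
apply: cvg_trans lim1; apply: near_eq_cvg; near=> n.
rewrite /window patchE ifT// inE/= in_itv/= -ler_norml.
apply: (@le_trans _ _ n%:R); last by rewrite ler_nat.
by near: n; exact: nbhs_infty_ger.
Unshelve. all: by end_near. Qed.

(** The window on its support, in a form to which the derivation rules apply.
*)
Let parabola N s : R := 1 + -1 * ((N^-1 * s) * (N^-1 * s)).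

Let parabolaN N s : parabola N (- s) = parabola N s.
Proof. by rewrite /parabola; ring. Qed.

Let parabola_end N : N != 0 -> parabola N N = 0.
Proof. by move=> N0; rewrite /parabola mulVf//; ring. Qed.

Let is_derive_parabola N x : is_derive x 1 (parabola N) (- 2 * N^-1 ^+ 2 * x).
Proof.
have d1 := is_derive_mull N^-1 (is_derive_id x (1 : R)).
apply: (is_derive_eq (is_derive_addf (is_derive_cst (1 : R) x (1 : R))
  (is_derive_mull (-1) (is_derive_mulf d1 d1)))).
by rewrite /=; ring.
Qed.

Let integral_window (g : R -> R) N :
  \int[mu]_s (window N s * g s) = \int[mu]_(s in `[- N, N]) (parabola N s * g s).
Proof.
rewrite [RHS]Rintegral_mkcond; apply: eq_Rintegral => s _.
rewrite /window !patchE; case: ifPn => _; last by rewrite mul0r.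
by congr (_ * _); rewrite /parabola; ring.
Qed.

(** The primitive comes from two integrations by parts. *)
Lemma integral_window_cos N a : 0 < N -> a != 0 ->
  \int[mu]_s (window N s * cos (a * s)) =
  4 * (sin (a * N) - a * N * cos (a * N)) / (a ^+ 3 * N ^+ 2).
Proof.
move=> N0 a0; have N1 : N != 0 by rewrite gt_eqF.
have ltN : - N < N by lra.
pose k1 := - 2 * (a * N) ^- 2; pose k2 := 2 / (a ^+ 3 * N ^+ 2).
pose F s := parabola N s * (a^-1 * sin (a * s)) +
            ((k1 * s) * cos (a * s) + k2 * sin (a * s)).
have dF x : is_derive x 1 F (parabola N x * cos (a * x)).
  apply: (is_derive_eq (is_derive_addf (is_derive_mulf (is_derive_parabola N x)
     (is_derive_mull a^-1 (is_derive_sin_mul a x)))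
     (is_derive_addf (is_derive_mulf (is_derive_mull k1 (is_derive_id x (1 : R)))
        (is_derive_cos_mul a x)) (is_derive_mull k2 (is_derive_sin_mul a x))))).
  by rewrite /k1 /k2 /=; field; rewrite a0 N1.
have cf : continuous (fun x => parabola N x * cos (a * x)).
  by move=> x; exact: is_derive_continuous
    (is_derive_mulf (is_derive_parabola N x) (is_derive_cos_mul a x)).
rewrite integral_window (Rintegral_FTC ltN cf dF) /F parabolaN parabola_end//.
rewrite !mulrN cosN sinN /k1 /k2.
by field; rewrite N1 a0.
Qed.

(** The integrand is odd; accordingly the primitive below is even. *)
Lemma integral_window_sin N a : 0 < N ->
  \int[mu]_s (window N s * sin (a * s)) = 0.
Proof.
move=> N0; have N1 : N != 0 by rewrite gt_eqF.
have [->|a0] := eqVneq a 0.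
  under eq_Rintegral do rewrite mul0r sin0 mulr0.
  by rewrite /Rintegral integral0.
have ltN : - N < N by lra.
pose k1 := - 2 * (a * N) ^- 2; pose k2 := - 2 / (a ^+ 3 * N ^+ 2).
pose F s := parabola N s * (- a^-1 * cos (a * s)) +
            ((k1 * s) * sin (a * s) + k2 * cos (a * s)).
have dF x : is_derive x 1 F (parabola N x * sin (a * x)).
  apply: (is_derive_eq (is_derive_addf (is_derive_mulf (is_derive_parabola N x)
     (is_derive_mull (- a^-1) (is_derive_cos_mul a x)))
     (is_derive_addf (is_derive_mulf (is_derive_mull k1 (is_derive_id x (1 : R)))
        (is_derive_sin_mul a x)) (is_derive_mull k2 (is_derive_cos_mul a x))))).
  by rewrite /k1 /k2 /=; field; rewrite a0 N1.
have cf : continuous (fun x => parabola N x * sin (a * x)).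
  by move=> x; exact: is_derive_continuous
    (is_derive_mulf (is_derive_parabola N x) (is_derive_sin_mul a x)).
rewrite integral_window (Rintegral_FTC ltN cf dF) /F parabolaN parabola_end//.
by rewrite !mulrN cosN sinN; ring.
Qed.

Lemma integrable_window N : 0 < N -> mu.-integrable setT (EFin \o window N).
Proof.
move=> N0; apply: (@le_integrable _ _ _ mu _ measurableT _ (EFin \o \1_`[- N, N])).
- by apply/measurable_EFinP; exact: measurable_window.
- move=> s _; rewrite /= lee_fin /window patchE indicE.
  case: ifPn => [sN|_]; last by rewrite normr0.
  rewrite normr1; have := window_le1 s N0.
  by rewrite /window patchE sN.
- exact: integrable_indic_itv.
Qed.

(** For `|N * a| <= 1` the trivial bound 2 * N suffices, and beyond that the
explicit value decays like 8 * N / (N * a) ^ 2; the Cauchy kernel on the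
right, whose integral does not depend on N, dominates both. *)
Lemma norm_integral_window_cos N a : 0 < N ->
  `|\int[mu]_s (window N s * cos (a * s))| <= 16 * N / (1 + (N * a) ^+ 2).
Proof.
move=> N0.
have triv : `|\int[mu]_s (window N s * cos (a * s))| <= 2 * N.
  rewrite -lee_fin EFin_normr_Rintegral//; last first.
    apply: (@le_integrable _ _ _ mu _ measurableT _ (EFin \o window N)).
    - apply/measurable_EFinP/measurable_funM; first exact: measurable_window.
      apply: continuous_measurable_fun => x.
      exact: is_derive_continuous (is_derive_cos_mul a x).
    - move=> s _; rewrite /= lee_fin normrM ler_piMr//.
      by rewrite ler_norml cos_geN1 cos_le1.
    - exact: integrable_window.
  apply: (le_trans (le_abse_integral _ _ _)) => //.
    apply/measurable_EFinP/measurable_funM; first exact: measurable_window.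
    apply: continuous_measurable_fun => x.
    exact: is_derive_continuous (is_derive_cos_mul a x).
  have -> : (2 * N)%:E = (\int[mu]_x (\1_`[- N, N] x)%:E)%E.
    rewrite integral_indic// setIT [RHS]lebesgue_measure_itv/= lte_fin.
    by rewrite gtrN// -EFinB; congr EFin; lra.
  apply: ge0_le_integral => //.
  - apply: measurableT_comp => //.
    apply/measurable_EFinP/measurable_funM; first exact: measurable_window.
    apply: continuous_measurable_fun => x.
    exact: is_derive_continuous (is_derive_cos_mul a x).
  - exact/measurable_EFinP/measurable_indic.
  move=> s _; rewrite /= lee_fin normrM indicE.
  have c1 : `|cos (a * s)| <= 1 by rewrite ler_norml cos_geN1 cos_le1.
  case: (boolP (s \in _)) => sN.
    by rewrite -[leRHS]mulr1 ler_pM// window_le1.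
  by rewrite /window patchE (negbTE sN) normr0 mul0r.
have [Na1|Na1] := leP `|N * a| 1.
  apply: (le_trans triv); rewrite ler_pdivlMr; last by rewrite ltr_pwDl// sqr_ge0.
  have : (N * a) ^+ 2 <= 1 by rewrite -real_normK ?num_real// expr_le1.
  by move=> h; nra.
have a0 : a != 0 by apply: contraTneq Na1 => ->; rewrite mulr0 normr0 ltr10.
rewrite integral_window_cos//.
set t := N * a; have t1 : 1 < `|t| by [].
have -> : 4 * (sin (a * N) - a * N * cos (a * N)) / (a ^+ 3 * N ^+ 2) =
  4 * N * ((sin t - t * cos t) / t ^+ 3).
  by rewrite /t (mulrC a N); field; rewrite a0 gt_eqF.
rewrite normrM (gtr0_norm (_ : 0 < 4 * N)) ?mulr_gt0//.
have t0 : 0 < `|t| by rewrite (lt_trans _ t1).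
have h : `|(sin t - t * cos t) / t ^+ 3| <= 2 / `|t| ^+ 2.
  rewrite normf_div normrX ler_pdivrMr ?exprn_gt0//.
  have -> : 2 / `|t| ^+ 2 * `|t| ^+ 3 = 2 * `|t| by field; rewrite gt_eqF.
  apply: (le_trans (ler_normB _ _)).
  have sb : `|sin t| <= 1 by rewrite ler_norml sin_geN1 sin_le1.
  have cb : `|cos t| <= 1 by rewrite ler_norml cos_geN1 cos_le1.
  by rewrite normrM; nra.
apply: (le_trans (ler_wpM2l _ h)); first by rewrite mulr_ge0// ltW.
rewrite -[t ^+ 2](real_normK (num_real t)).
rewrite mulrA ler_pdivrMr ?exprn_gt0// [leRHS]mulrAC ler_pdivlMr; last by rewrite ltr_pwDl// sqr_ge0.
have : 1 < `|t| ^+ 2 by rewrite exprn_egt1.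
move: (`|t| ^+ 2) => u u1.
by nra.
Qed.


Lemma integral_oneDsqr : (\int[mu]_x (1 + x ^+ 2)^-1%:E = pi%:E)%E.
Proof.
rewrite ge0_symfun_integralT; last 3 first.
- by move=> x; rewrite invr_ge0 addr_ge0// sqr_ge0.
- exact: continuous_oneDsqrV.
- by move=> x; rewrite /= sqrrN.
rewrite -set_itvcy; have := @integral0y_oneDsqr R; rewrite /oneDsqr => ->.
by rewrite -EFinM; congr EFin; field.
Qed.

(** The affine substitution u = N * `|c| * (x - y) absorbs N, which is what
makes the final estimate uniform in N. *)
Lemma integral_cauchy (N c y : R) : 0 < N -> c != 0 ->
  (\int[mu]_x (16 * N / (1 + (N * (c * (x - y))) ^+ 2))%:E = (16 * pi / `|c|)%:E)%E.
Proof.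
move=> N0 c0; have c1 : 0 < `|c| by rewrite normr_gt0.
pose k := N * `|c|; have k0 : 0 < k by rewrite mulr_gt0.
pose F (x : R) : R := k * x + - (k * y).
pose G (u : R) : R := 16 / `|c| * (1 + u ^+ 2)^-1.
have dF x : is_derive x 1 F k.
  apply: (is_derive_eq (is_derive_addf (is_derive_mull k (is_derive_id x (1 : R)))
    (is_derive_cst (- (k * y)) x (1 : R)))).
  by rewrite /=; ring.
have F' : derive1 F = cst k by apply/funext => x; rewrite derive1E; exact: derive_val.
transitivity (\int[mu]_x (((G \o F) * derive1 F) x)%:E)%E.
  apply: eq_integral => x _; rewrite F' /=; congr EFin.
  rewrite fctE /= /G /F /k.
  have -> : (N * (c * (x - y))) ^+ 2 = (N * `|c| * x + - (N * `|c| * y)) ^+ 2.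
    by rewrite -mulrBr -mulrA !exprMn real_normK ?num_real.
  by field; rewrite !gt_eqF// ltr_pwDl// sqr_ge0.
have cG : continuous G.
  move=> x; apply: cvgM; first exact: cvg_cst.
  exact: continuous_oneDsqrV.
rewrite -increasing_ge0_integration_by_substitutionT//.
- rewrite /G; under eq_integral do rewrite EFinM.
  rewrite ge0_integralZl//.
  + rewrite integral_oneDsqr -EFinM; congr EFin; field.
    by rewrite gt_eqF.
  + apply/measurable_EFinP; apply: continuous_measurable_fun.
    exact: (@continuous_oneDsqrV R).
  + by move=> x _; rewrite lee_fin invr_ge0 addr_ge0// sqr_ge0.
- by move=> x z xz; rewrite /F ltrD2r ltr_pM2l.
- by rewrite F' => x; exact: cvg_cst.
- by rewrite F'; exact: is_cvg_cst.
- by rewrite F'; exact: is_cvg_cst.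
- apply/cvgrNyPle => A; exists (k^-1 * (A + k * y)); split; first exact: num_real.
  by move=> z /ltW; rewrite ler_pdivlMl// /F lerBlDr.
- apply/cvgryPge => A; exists (k^-1 * (A + k * y)); split; first exact: num_real.
  by move=> z /ltW; rewrite ler_pdivrMl// /F lerBrDr.
- by move=> x; rewrite /G mulr_ge0// invr_ge0 addr_ge0// sqr_ge0.
Qed.

End ParabolicWindow.

(** * Bounded multipliers and Schur's test *)

Section BoundedMultipliers.
Context d (X : measurableType d) (R : realType).
Variable m : {measure set X -> \bar R}.
Implicit Types u v : X -> R.

Lemma integrable_mul_bounded u v B : m.-integrable setT (EFin \o u) ->
  measurable_fun setT v -> (forall x, `|v x| <= B) ->
  m.-integrable setT (fun x => (u x * v x)%:E).
Proof.
move=> iu mv vB.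
apply: (@le_integrable _ _ _ _ _ measurableT _ (fun x => (B * u x)%:E)).
- apply/measurable_EFinP/measurable_funM => //.
  exact/measurable_EFinP/(measurable_int m).
- move=> x _; rewrite /= lee_fin !normrM mulrC ler_wpM2r//.
  by rewrite (le_trans (vB x))// ler_norm.
- exact: (integrableZl measurableT _ iu).
Qed.

(** An infinite or undefined integral causes no exception, since the real
integral is then 0. *)
Lemma norm_Rintegral_le u : measurable_fun setT u ->
  (`|\int[m]_x u x|%:E <= \int[m]_x `|u x|%:E)%E.
Proof.
move=> mu; have mEu : measurable_fun setT (EFin \o u) by exact/measurable_EFinP.
apply: le_trans (le_abse_integral _ measurableT mEu).
by rewrite /Rintegral; case: (integral _ _ _) => //=; rewrite leey.
Qed.

End BoundedMultipliers.

Section SchurTest.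
Context d (X : measurableType d) (R : realType).
Variable m : {sigma_finite_measure set X -> \bar R}.
Variables (k : X * X -> R) (A : R) (u : X -> R).
Hypothesis A0 : 0 <= A.
Hypotheses (mk : measurable_fun setT k) (k0 : forall z, 0 <= k z).
Hypotheses (mu : measurable_fun setT u).
Hypothesis kA1 : forall x, (\int[m]_y (k (x, y))%:E <= A%:E)%E.
Hypothesis kA2 : forall y, (\int[m]_x (k (x, y))%:E <= A%:E)%E.

(** Split `|u x| * `|u y| <= (u x ^+ 2 + u y ^+ 2) / 2 and integrate the
kernel first, in y for one term and in x for the other. *)
Lemma schur_test :
  (\int[m]_x \int[m]_y (`|u x| * `|u y| * k (x, y))%:E
   <= A%:E * \int[m]_x (u x ^+ 2)%:E)%E.
Proof.
pose f (z : X * X) := (2^-1 * u z.1 ^+ 2 * k z)%:E.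
pose g (z : X * X) := (2^-1 * u z.2 ^+ 2 * k z)%:E.
pose h (z : X * X) := (`|u z.1| * `|u z.2| * k z)%:E.
have mu1 : measurable_fun setT (fun z : X * X => u z.1) by exact: measurableT_comp.
have mu2 : measurable_fun setT (fun z : X * X => u z.2) by exact: measurableT_comp.
have mf : measurable_fun setT f.
  apply/measurable_EFinP/measurable_funM => //; apply: measurable_funM => //.
  exact: measurable_funX.
have mg : measurable_fun setT g.
  apply/measurable_EFinP/measurable_funM => //; apply: measurable_funM => //.
  exact: measurable_funX.
have mh : measurable_fun setT h.
  apply/measurable_EFinP/measurable_funM => //.
  by apply: measurable_funM; apply: measurableT_comp.
have f0 z : (0 <= f z)%E by rewrite lee_fin mulr_ge0// mulr_ge0 ?sqr_ge0//.
have g0 z : (0 <= g z)%E by rewrite lee_fin mulr_ge0// mulr_ge0 ?sqr_ge0//.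
have h0 z : (0 <= h z)%E by rewrite lee_fin !mulr_ge0.
have hfg z : (h z <= f z + g z)%E.
  rewrite -EFinD lee_fin -mulrDl ler_wpM2r// -(real_normK (num_real (u z.1))).
  rewrite -(real_normK (num_real (u z.2))).
  have := sqr_ge0 (`|u z.1| - `|u z.2|); rewrite sqrrB; lra.
have mu2i : measurable_fun setT (fun x => (u x ^+ 2)%:E).
  exact/measurable_EFinP/measurable_funX.
have half (q : X -> \bar R) : measurable_fun setT q -> (forall x, 0 <= q x)%E ->
    (forall x, q x <= A%:E)%E -> (\int[m]_x ((2^-1 * u x ^+ 2)%:E * q x)
    <= (2^-1)%:E * (A%:E * \int[m]_x (u x ^+ 2)%:E))%E.
  move=> mq q0 qA.
  have sq0 x : (0 <= (u x ^+ 2)%:E)%E by rewrite lee_fin sqr_ge0.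
  rewrite -ge0_integralZl//.
  rewrite -ge0_integralZl//; last 2 first.
  - exact: emeasurable_funM.
  - by move=> x _; rewrite mule_ge0.
  apply: ge0_le_integral => //.
  - by move=> x _; rewrite mule_ge0// lee_fin mulr_ge0// sqr_ge0.
  - apply: emeasurable_funM => //; apply/measurable_EFinP/measurable_funM => //.
    exact: measurable_funX.
  - by do 2 apply: emeasurable_funM => //.
  move=> x _; rewrite EFinM -muleA lee_pmul2l// muleC.
  exact: lee_wpmul2r.
apply: (@le_trans _ _ (\int[m]_x \int[m]_y (f (x, y) + g (x, y)))%E).
  apply: ge0_le_integral => //.
  - by move=> x _; apply: integral_ge0 => y _; exact: h0 (x, y).
  - exact: (@measurable_fun_fubini_tonelli_F _ _ _ _ _ m h).
  - apply: (@measurable_fun_fubini_tonelli_F _ _ _ _ _ m (f \+ g)%E).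
      exact: emeasurable_funD.
    by move=> z; rewrite adde_ge0.
  move=> x _; apply: ge0_le_integral => //.
  - by move=> y _; exact: h0 (x, y).
  - exact: (measurable_fun_pair2 x mh).
  - exact: (measurable_fun_pair2 x (emeasurable_funD mf mg)).
  - by move=> y _; exact: hfg (x, y).
under eq_integral => x _.
  rewrite ge0_integralD//; last 2 first.
    exact: (measurable_fun_pair2 x mf).
    exact: (measurable_fun_pair2 x mg).
  over.
rewrite ge0_integralD//; last 4 first.
- by move=> x _; apply: integral_ge0.
- exact: (@measurable_fun_fubini_tonelli_F _ _ _ _ _ m f).
- by move=> x _; apply: integral_ge0.
- exact: (@measurable_fun_fubini_tonelli_F _ _ _ _ _ m g).
rewrite [X in (_ + X)%E](@fubini_tonelli _ _ _ _ _ m m g)//.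
have -> : (A%:E * \int[m]_x (u x ^+ 2)%:E =
    (2^-1)%:E * (A%:E * \int[m]_x (u x ^+ 2)%:E) +
    (2^-1)%:E * (A%:E * \int[m]_x (u x ^+ 2)%:E))%E.
  rewrite -ge0_muleDl// -EFinD (_ : 2^-1 + 2^-1 = 1) ?mul1e//.
  by field.
apply: leeD.
- under eq_integral => x _.
    rewrite /f /=; under eq_integral do rewrite EFinM.
    rewrite ge0_integralZl//; last 3 first.
    - by apply/measurable_EFinP; exact: (measurable_fun_pair2 x mk).
    - by move=> y _; rewrite lee_fin.
    - by rewrite lee_fin mulr_ge0// sqr_ge0.
    over.
  apply: half => //; last by move=> x; apply: integral_ge0 => y _; rewrite lee_fin.
  apply: (@measurable_fun_fubini_tonelli_F _ _ _ _ _ m (EFin \o k)).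
    exact/measurable_EFinP.
  by move=> z; rewrite lee_fin.
- under eq_integral => y _.
    rewrite /g /=; under eq_integral do rewrite EFinM.
    rewrite ge0_integralZl//; last 3 first.
    - by apply/measurable_EFinP; exact: (measurable_fun_pair1 y mk).
    - by move=> x _; rewrite lee_fin.
    - by rewrite lee_fin mulr_ge0// sqr_ge0.
    over.
  apply: half => //; last by move=> x; apply: integral_ge0 => y _; rewrite lee_fin.
  apply: (@measurable_fun_fubini_tonelli_G _ _ _ _ _ m (EFin \o k)).
    exact/measurable_EFinP.
  by move=> z; rewrite lee_fin.
Qed.

End SchurTest.

(** * The TT-star argument for oscillatory kernels *)

Section OscillatoryTTstar.
Context d1 d2 (X : measurableType d1) (T : measurableType d2) (R : realType).
Variables (m : {sigma_finite_measure set X -> \bar R})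
          (n : {sigma_finite_measure set T -> \bar R}).
Variables (theta : X * T -> R) (W : T -> R) (u : X -> R).
Hypothesis mtheta : measurable_fun setT theta.
Hypothesis iu : m.-integrable setT (EFin \o u).

Definition cos_transform t := \int[m]_x (u x * cos (theta (x, t))).
Definition sin_transform t := \int[m]_x (u x * sin (theta (x, t))).

Let mu : measurable_fun setT u.
Proof. exact/measurable_EFinP/(measurable_int m). Qed.

Let mcos : measurable_fun [set: R] (@cos R).
Proof. by apply: continuous_measurable_fun; exact: continuous_cos. Qed.

Let msin : measurable_fun [set: R] (@sin R).
Proof. by apply: continuous_measurable_fun; exact: continuous_sin. Qed.

Let cos1 (s : R) : `|cos s| <= 1.
Proof. by rewrite ler_norml cos_geN1 cos_le1. Qed.

Let sin1 (s : R) : `|sin s| <= 1.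
Proof. by rewrite ler_norml sin_geN1 sin_le1. Qed.

Let iucos t : m.-integrable setT (fun x => (u x * cos (theta (x, t)))%:E).
Proof.
apply: (integrable_mul_bounded (B := 1)) => //.
by apply: measurableT_comp => //; exact: measurable_fun_pair1.
Qed.

Let iusin t : m.-integrable setT (fun x => (u x * sin (theta (x, t)))%:E).
Proof.
apply: (integrable_mul_bounded (B := 1)) => //.
by apply: measurableT_comp => //; exact: measurable_fun_pair1.
Qed.

Lemma measurable_cos_transform : measurable_fun setT cos_transform.
Proof.
apply: (@measurable_Rintegral_param _ _ T X R m (fun z => u z.2 * cos (theta (z.2, z.1)))).
apply: measurable_funM; first exact: measurableT_comp.
apply: measurableT_comp => //; apply: (measurableT_comp mtheta).
exact: measurable_swap.
Qed.

Lemma measurable_sin_transform : measurable_fun setT sin_transform.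
Proof.
apply: (@measurable_Rintegral_param _ _ T X R m (fun z => u z.2 * sin (theta (z.2, z.1)))).
apply: measurable_funM; first exact: measurableT_comp.
apply: measurableT_comp => //; apply: (measurableT_comp mtheta).
exact: measurable_swap.
Qed.

Lemma norm_transforms_le t :
  `|cos_transform t| <= \int[m]_x `|u x| /\ `|sin_transform t| <= \int[m]_x `|u x|.
Proof.
have iau : m.-integrable setT (fun x => `|u x|%:E).
  by have := integrable_abse iu; apply: eq_integrable.
split.
- apply: le_trans (le_normr_Rintegral measurableT (iucos t)) _.
  apply: le_Rintegral => //; first exact: (integrable_abse (iucos t)).
  by move=> x _; rewrite normrM ler_piMr.
- apply: le_trans (le_normr_Rintegral measurableT (iusin t)) _.
  apply: le_Rintegral => //; first exact: (integrable_abse (iusin t)).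
  by move=> x _; rewrite normrM ler_piMr.
Qed.

Let cos_difference_integral t x :
  \int[m]_y (u x * u y * cos (theta (x, t) - theta (y, t))) =
  cos_transform t * (u x * cos (theta (x, t))) +
  sin_transform t * (u x * sin (theta (x, t))).
Proof.
transitivity (\int[m]_y (u x * cos (theta (x, t)) * (u y * cos (theta (y, t))) +
    u x * sin (theta (x, t)) * (u y * sin (theta (y, t))))).
  by apply: eq_Rintegral => y _; rewrite cosB; ring.
rewrite RintegralD//; last 2 first.
- exact: (integrableZl measurableT _ (iucos t)).
- exact: (integrableZl measurableT _ (iusin t)).
rewrite !RintegralZl//; [|exact: iusin|exact: iucos].
by rewrite /cos_transform /sin_transform; ring.
Qed.

Let integrable_cos_difference t : m.-integrable setT
  (fun x => (\int[m]_y (u x * u y * cos (theta (x, t) - theta (y, t))))%:E).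
Proof.
apply: eq_integrable (integrableD measurableT
  (integrableZl measurableT (cos_transform t) (iucos t))
  (integrableZl measurableT (sin_transform t) (iusin t))) => //.
by move=> x _; rewrite cos_difference_integral.
Qed.

(** The cosine of the difference is the real part of exp (i theta (x, t))
times the conjugate of exp (i theta (y, t)); in the double integral the
imaginary part cancels by symmetry in x and y. *)
Lemma sum_sqr_transforms t :
  cos_transform t ^+ 2 + sin_transform t ^+ 2 =
  \int[m]_x \int[m]_y (u x * u y * cos (theta (x, t) - theta (y, t))).
Proof.
under eq_Rintegral do rewrite cos_difference_integral.
rewrite RintegralD//; last 2 first.
- exact: (integrableZl measurableT _ (iucos t)).
- exact: (integrableZl measurableT _ (iusin t)).
by rewrite !RintegralZl//; [exact: iusin|exact: iucos].
Qed.

Variables (k : X * X -> R) (A : R).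
Hypotheses (iW : n.-integrable setT (EFin \o W)) (A0 : 0 <= A).
Hypotheses (mk : measurable_fun setT k).
Hypothesis kA1 : forall x, (\int[m]_y (k (x, y))%:E <= A%:E)%E.
Hypothesis kA2 : forall y, (\int[m]_x (k (x, y))%:E <= A%:E)%E.
Hypothesis kW : forall x y,
  `|\int[n]_t (W t * cos (theta (x, t) - theta (y, t)))| <= k (x, y).

(** The weighted energy of the transform is a quadratic form in u with kernel
the W-average of cos (theta (x, t) - theta (y, t)), which Schur's test bounds.
Both changes in the order of integration are licensed by the integrability of
W and u. *)
Lemma TTstar :
  ((\int[n]_t (W t * (cos_transform t ^+ 2 + sin_transform t ^+ 2)))%:E
   <= A%:E * \int[m]_x (u x ^+ 2)%:E)%E.
Proof.
have k0 z : 0 <= k z by case: z => x y; exact: le_trans (kW x y).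
(* The full integrand, with variables in the order t, x, y. *)
pose G (p : (T * X) * X) :=
  W p.1.1 * (u p.1.2 * u p.2 * cos (theta (p.1.2, p.1.1) - theta (p.2, p.1.1))).
have mW : measurable_fun setT W by exact/measurable_EFinP/(measurable_int n).
have mG : measurable_fun setT G.
  apply: measurable_funM.
    by apply: (measurableT_comp mW); exact: measurableT_comp.
  apply: measurable_funM.
    apply: measurable_funM; last exact: measurableT_comp.
    by apply: (measurableT_comp mu); exact: measurableT_comp.
  apply: (measurableT_comp mcos); apply: measurable_funB.
    apply: (measurableT_comp mtheta); apply: measurable_fun_pair; exact: measurableT_comp.
  apply: (measurableT_comp mtheta); apply: measurable_fun_pair => //.
  exact: measurableT_comp.
pose G1 (p : T * X) := \int[m]_y G (p, y).
have mG1 : measurable_fun setT G1 by exact: measurable_Rintegral_param.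
pose I := \int[m]_x `|u x|.
have iau : m.-integrable setT (fun x => `|u x|%:E).
  by have := integrable_abse iu; apply: eq_integrable.
have iG1 t x : m.-integrable setT (fun y => (G (t, x, y))%:E).
  have := integrableZl measurableT (W t * u x) (integrable_mul_bounded (B := 1) iu 
    (v := fun y => cos (theta (x, t) - theta (y, t))) _ _).
  move=> h; apply: eq_integrable (h _ _) => //.
  - by move=> y _; rewrite /G /= -EFinM; congr EFin; ring.
  - apply: (measurableT_comp mcos); apply: measurable_funB => //.
    exact: measurable_fun_pair1.
have dG1 t x : `|G1 (t, x)| <= `|W t| * `|u x * I|.
  apply: le_trans (le_normr_Rintegral measurableT (iG1 t x)) _.
  have I0 : 0 <= I by exact: Rintegral_ge0.
  rewrite normrM (ger0_norm I0) mulrA -RintegralZl//.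
  apply: le_Rintegral => //.
  - exact: integrable_abse (iG1 t x).
  - exact: (integrableZl measurableT _ iau).
  move=> y _; rewrite /G /= !normrM !mulrA ler_piMr ?mulr_ge0//.
have iuI : m.-integrable setT (EFin \o (fun x => u x * I)).
  by have := integrableZr measurableT I iu; apply: eq_integrable.
have -> : \int[n]_t (W t * (cos_transform t ^+ 2 + sin_transform t ^+ 2)) =
    \int[n]_t \int[m]_x G1 (t, x).
  apply: eq_Rintegral => t _; rewrite sum_sqr_transforms -RintegralZl//.
    apply: eq_Rintegral => x _; rewrite -RintegralZl//.
    apply: (@integrable_mul_bounded _ _ _ m _ _ 1) => //.
      by have := integrableZl measurableT (u x) iu; apply: eq_integrable.
    apply: (measurableT_comp mcos); apply: measurable_funB => //.
    exact: (measurable_fun_pair1 t mtheta).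
  exact: integrable_cos_difference.
rewrite (dominated_Rintegral_swap mG1 iW iuI dG1).
have -> : \int[m]_x \int[n]_t G1 (t, x) =
    \int[m]_x \int[m]_y (u x * u y * \int[n]_t (W t * cos (theta (x, t) - theta (y, t)))).
  apply: eq_Rintegral => x _.
  pose Gx (p : T * X) := G (p.1, x, p.2).
  have mGx : measurable_fun setT Gx.
    apply: (measurableT_comp mG); apply: measurable_fun_pair => //.
    exact: measurable_fun_pair.
  have iux : m.-integrable setT (EFin \o (fun y => u x * u y)).
    by have := integrableZl measurableT (u x) iu; apply: eq_integrable.
  have dGx t y : `|Gx (t, y)| <= `|W t| * `|u x * u y|.
    by rewrite /Gx /G /= !normrM ler_wpM2l// ler_piMr// mulr_ge0.
  rewrite (dominated_Rintegral_swap mGx iW iux dGx).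
  apply: eq_Rintegral => y _; rewrite -RintegralZl//; last first.
    apply: (@integrable_mul_bounded _ _ _ n _ _ 1) => //.
    apply: (measurableT_comp mcos); apply: measurable_funB;
      exact: (measurable_fun_pair2 _ mtheta).
  by apply: eq_Rintegral => t _; rewrite /Gx /G /=; ring.
pose KK (p : X * X) := \int[n]_t (W t * cos (theta (p.1, t) - theta (p.2, t))).
have mKK : measurable_fun setT KK.
  apply: (@measurable_Rintegral_param _ _ (X * X)%type T R n
    (fun q => W q.2 * cos (theta (q.1.1, q.2) - theta (q.1.2, q.2)))).
  apply: measurable_funM; first exact: measurableT_comp.
  apply: (measurableT_comp mcos); apply: measurable_funB;
    by apply: (measurableT_comp mtheta); apply: measurable_fun_pair => //; exact: measurableT_comp.
pose H (p : X * X) := u p.1 * u p.2 * KK p.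
have mH : measurable_fun setT H.
  by apply: measurable_funM => //; apply: measurable_funM; exact: measurableT_comp.
have mnH : measurable_fun setT (fun p => `|H p|%:E).
  by apply/measurable_EFinP; exact: measurableT_comp.
pose S (p : X * X) := (`|u p.1| * `|u p.2| * k p)%:E.
have mS : measurable_fun setT S.
  apply/measurable_EFinP/measurable_funM => //.
  by apply: measurable_funM; apply: measurableT_comp => //; exact: measurableT_comp.
have S0 p : (0 <= S p)%E by rewrite lee_fin !mulr_ge0.
have mH1 : measurable_fun setT (fun x => \int[m]_y H (x, y)).
  exact: measurable_Rintegral_param.
apply: (@le_trans _ _ `|\int[m]_x \int[m]_y H (x, y)|%:E).
  by rewrite lee_fin ler_norm.
apply: le_trans (norm_Rintegral_le _ mH1) _.
apply: le_trans (schur_test A0 mk k0 mu kA1 kA2).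
apply: ge0_le_integral => //.
- by apply/measurable_EFinP; exact: measurableT_comp.
- exact: (@measurable_fun_fubini_tonelli_F _ _ _ _ _ m S).
move=> x _; apply: le_trans (norm_Rintegral_le _ (measurable_fun_pair2 x mH)) _.
apply: ge0_le_integral => //.
- exact: (measurable_fun_pair2 x mnH).
- exact: (measurable_fun_pair2 x mS).
move=> y _; rewrite lee_fin /H /= !normrM ler_wpM2l ?mulr_ge0//.
exact: kW.
Qed.

End OscillatoryTTstar.

(** * The Fourier transform on square integrable functions of the plane *)

Section ProductIntegrals.
Context d1 d2 (X : measurableType d1) (Y : measurableType d2) (R : realType).
Variables (m1 : {sigma_finite_measure set X -> \bar R})
          (m2 : {sigma_finite_measure set Y -> \bar R}).

Lemma Rintegral_prodM (f : X -> R) (g : Y -> R) :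
  m1.-integrable setT (EFin \o f) -> m2.-integrable setT (EFin \o g) ->
  \int[(m1 \x m2)%E]_p (f p.1 * g p.2) = \int[m1]_x f x * \int[m2]_y g y.
Proof.
move=> ifm igm; pose F (p : X * Y) := f p.1 * g p.2.
have mf : measurable_fun setT f by exact/measurable_EFinP/(measurable_int m1).
have mg : measurable_fun setT g by exact/measurable_EFinP/(measurable_int m2).
have mF : measurable_fun setT F by apply: measurable_funM; exact: measurableT_comp.
have dF x y : `|F (x, y)| <= `|f x| * `|g y| by rewrite normrM.
have iF := dominated_integrable_prod mF ifm igm dF.
rewrite {1}/Rintegral -(integral12_prod_meas1 iF).
transitivity (\int[m1]_x \int[m2]_y F (x, y)).
  congr fine; apply: eq_integral => x _; rewrite /fubini_F fineK//.
  exact: integrable_fin_num (dominated_integrable_section1 mF igm dF x).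
under eq_Rintegral => x _ do rewrite /F /= RintegralZl//.
by rewrite RintegralZr.
Qed.

Lemma integrable_prodM (f : X -> R) (g : Y -> R) :
  m1.-integrable setT (EFin \o f) -> m2.-integrable setT (EFin \o g) ->
  (m1 \x m2)%E.-integrable setT (fun p => (f p.1 * g p.2)%:E).
Proof.
move=> ifm igm; apply: (dominated_integrable_prod _ ifm igm) => [|x y].
  have mf : measurable_fun setT f by exact/measurable_EFinP/(measurable_int m1).
  have mg : measurable_fun setT g by exact/measurable_EFinP/(measurable_int m2).
  by apply: measurable_funM; exact: measurableT_comp.
by rewrite normrM.
Qed.

Lemma ge0_integral_prodM (f : X -> \bar R) (g : Y -> \bar R) :
  measurable_fun setT f -> measurable_fun setT g ->
  (forall x, 0 <= f x)%E -> (forall y, 0 <= g y)%E ->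
  (\int[(m1 \x m2)%E]_p (f p.1 * g p.2) = \int[m1]_x f x * \int[m2]_y g y)%E.
Proof.
move=> mf mg f0 g0; rewrite fubini_tonelli1//; last 2 first.
- by apply: emeasurable_funM; exact: measurableT_comp.
- by move=> p; rewrite mule_ge0.
rewrite -ge0_integralZr//; last exact: integral_ge0.
by apply: eq_integral => x _; rewrite /fubini_F /= ge0_integralZl.
Qed.

End ProductIntegrals.

Notation plane R := (measurableTypeR R * measurableTypeR R)%type.

(** Lebesgue measure of the plane under a name of its own, which carries the
structure of a sigma-finite measure. *)
Definition area {R : realType} : set (plane R) -> \bar R := leb2 R.

HB.instance Definition _ (R : realType) := Measure.copy (@area R) (leb2 R).
HB.instance Definition _ (R : realType) := Measure_isSigmaFinite.Build _ (plane R) R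
  (@area R) (product_sigma_finite lebesgue_measure lebesgue_measure).


Section Bessel.
Context {R : realType}.
Local Notation mu := (@lebesgue_measure R).
Local Notation mu2 := (@area R).
Variables (c : R) (u : plane R -> R).
Hypotheses (c0 : c != 0) (iu : mu2.-integrable setT (EFin \o u)).

Definition phase (p : plane R * plane R) : R := c * dot p.1 p.2.

Lemma measurable_phase : measurable_fun setT phase.
Proof.
apply: measurable_funM => //.
by apply: measurable_funD; apply: measurable_funM;
  apply: measurableT_comp => //; apply: measurableT_comp.
Qed.

Let mwindow N : measurable_fun [set: measurableTypeR R] (window N) := @measurable_window R N.

Let iwcos (N a : R) : 0 < N -> mu.-integrable setT (EFin \o (fun s => window N s * cos (a * s))).
Proof.
move=> N0; apply: (integrable_mul_bounded (B := 1)).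
- exact: integrable_window.
- apply: continuous_measurable_fun => x.
  exact: is_derive_continuous (is_derive_cos_mul a x).
- by move=> x; rewrite ler_norml cos_geN1 cos_le1.
Qed.

Let iwsin (N a : R) : 0 < N -> mu.-integrable setT (EFin \o (fun s => window N s * sin (a * s))).
Proof.
move=> N0; apply: (integrable_mul_bounded (B := 1)).
- exact: integrable_window.
- apply: continuous_measurable_fun => x.
  exact: is_derive_continuous (is_derive_sin_mul a x).
- by move=> x; rewrite ler_norml sin_geN1 sin_le1.
Qed.

(** By the addition formula the integral splits into a product of cosine
integrals and a product of sine integrals; the latter vanish by parity. *)
Lemma integral_window2_cos (N a b : R) : 0 < N ->
  \int[mu2]_t (window N t.1 * window N t.2 * cos (a * t.1 + b * t.2)) =
  \int[mu]_s (window N s * cos (a * s)) * \int[mu]_s (window N s * cos (b * s)).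
Proof.
move=> N0.
transitivity (\int[mu2]_t ((window N t.1 * cos (a * t.1)) * (window N t.2 * cos (b * t.2))
   - (window N t.1 * sin (a * t.1)) * (window N t.2 * sin (b * t.2)))).
  by apply: eq_Rintegral => t _; rewrite cosD; ring.
rewrite RintegralB//; last 2 first.
- exact: (integrable_prodM (iwcos a N0) (iwcos b N0)).
- exact: (integrable_prodM (iwsin a N0) (iwsin b N0)).
rewrite (Rintegral_prodM (iwcos a N0) (iwcos b N0)).
rewrite (Rintegral_prodM (iwsin a N0) (iwsin b N0)).
by rewrite !integral_window_sin// mulr0 subr0.
Qed.

Local Notation C := (cos_transform mu2 phase u).
Local Notation S := (sin_transform mu2 phase u).

Let cauchy N s : R := 16 * N / (1 + (N * (c * s)) ^+ 2).

Let cauchy_ge0 (N s : R) : 0 < N -> 0 <= cauchy N s.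
Proof.
by move=> N0; rewrite divr_ge0 ?mulr_ge0 ?(ltW N0)// addr_ge0// sqr_ge0.
Qed.

Let mcauchy N : measurable_fun [set: measurableTypeR R] (cauchy N).
Proof.
apply: continuous_measurable_fun => x.
apply: cvgM; first exact: cvg_cst.
apply: (@continuous_comp _ _ _ (fun s => N * (c * s)) (fun s => (1 + s ^+ 2)^-1)).
  by apply: cvgM; [exact: cvg_cst|apply: cvgM => //; exact: cvg_cst].
exact: (@continuous_oneDsqrV R).
Qed.

Let cauchyN N s : cauchy N (- s) = cauchy N s.
Proof. by rewrite /cauchy !mulrN sqrrN. Qed.

(** The window depends on N but its kernel is dominated by a product of Cauchy
kernels, both with integral 16 * pi / `|c|, so the constant is the same for
all N. *)
Lemma bessel_window (N : R) : 0 < N ->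
  ((\int[mu2]_t (window N t.1 * window N t.2 * (C t ^+ 2 + S t ^+ 2)))%:E
   <= ((16 * pi / `|c|) ^+ 2)%:E * \int[mu2]_x (u x ^+ 2)%:E)%E.
Proof.
move=> N0.
pose k (p : plane R * plane R) := cauchy N (p.1.1 - p.2.1) * cauchy N (p.1.2 - p.2.2).
have kA (y : plane R) : (\int[mu2]_x (k (x, y))%:E = ((16 * pi / `|c|) ^+ 2)%:E)%E.
  transitivity (\int[mu2]_x ((cauchy N (x.1 - y.1))%:E * (cauchy N (x.2 - y.2))%:E))%E.
    by apply: eq_integral => x _; rewrite -EFinM.
  have mc (r : R) : measurable_fun [set: measurableTypeR R] (fun s => (cauchy N (s - r))%:E).
    apply/measurable_EFinP; apply: (measurableT_comp (mcauchy N)).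
    exact: measurable_funB.
  rewrite (@ge0_integral_prodM _ _ _ _ R mu mu (fun s => (cauchy N (s - y.1))%:E)
    (fun s => (cauchy N (s - y.2))%:E))//.
  - by rewrite !integral_cauchy// -EFinM -expr2.
  - by move=> x; rewrite lee_fin cauchy_ge0.
  - by move=> x; rewrite lee_fin cauchy_ge0.
have kC (x y : plane R) : k (x, y) = k (y, x).
  by rewrite /k /= -(opprB y.1) -(opprB y.2) !cauchyN.
pose W (t : plane R) := window N t.1 * window N t.2.
have iW : mu2.-integrable setT (EFin \o W).
  exact: (integrable_prodM (integrable_window N0) (integrable_window N0)).
have mk : measurable_fun setT k.
  apply: measurable_funM; apply: (measurableT_comp (mcauchy N));
    by apply: measurable_funB; apply: measurableT_comp => //; apply: measurableT_comp.
have kA1 x : (\int[mu2]_y (k (x, y))%:E <= ((16 * pi / `|c|) ^+ 2)%:E)%E.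
  by under eq_integral do rewrite kC; rewrite kA.
have kA2 y : (\int[mu2]_x (k (x, y))%:E <= ((16 * pi / `|c|) ^+ 2)%:E)%E.
  by rewrite kA.
have kW x y : `|\int[mu2]_t (W t * cos (phase (x, t) - phase (y, t)))| <= k (x, y).
  have -> : \int[mu2]_t (W t * cos (phase (x, t) - phase (y, t))) =
    \int[mu2]_t (window N t.1 * window N t.2 *
       cos (c * (x.1 - y.1) * t.1 + c * (x.2 - y.2) * t.2)).
    apply: eq_Rintegral => t _; congr (_ * cos _).
    by rewrite /phase /dot /=; ring.
  rewrite integral_window2_cos// normrM ler_pM//; exact: norm_integral_window_cos.
exact: (TTstar measurable_phase iu iW (sqr_ge0 _) mk kA1 kA2 kW).
Qed.

(** Half of Plancherel's theorem, with a constant that is not sharp: let the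
windows increase to 1 in the windowed estimate. The power `|c| ^- 2 is the
exact scaling in the frequency c. *)
Lemma bessel :
  (\int[mu2]_t (C t ^+ 2 + S t ^+ 2)%:E
   <= ((16 * pi / `|c|) ^+ 2)%:E * \int[mu2]_x (u x ^+ 2)%:E)%E.
Proof.
have mC := measurable_cos_transform measurable_phase iu.
have mS := measurable_sin_transform measurable_phase iu.
pose I := \int[mu2]_x `|u x|.
pose e t := C t ^+ 2 + S t ^+ 2.
have e0 t : 0 <= e t by rewrite addr_ge0 ?sqr_ge0.
have me : measurable_fun setT e by apply: measurable_funD; exact: measurable_funX.
have eI t : `|e t| <= 2 * I ^+ 2.
  rewrite ger0_norm ?e0// /e; have [CI SI] := norm_transforms_le measurable_phase iu t.
  have I0 : 0 <= I by exact: Rintegral_ge0.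
  have CI2 : C t ^+ 2 <= I ^+ 2.
    by rewrite -[leLHS]real_normK ?num_real// lerXn2r ?nnegrE.
  have SI2 : S t ^+ 2 <= I ^+ 2.
    by rewrite -[leLHS]real_normK ?num_real// lerXn2r ?nnegrE.
  by rewrite mulr_natl mulr2n lerD.
pose g (n : nat) (t : plane R) := (window n.+1%:R t.1 * window n.+1%:R t.2 * e t)%:E.
have w0 n s : 0 <= window n.+1%:R s :> R by exact: window_ge0.
have mg n : measurable_fun setT (g n).
  apply/measurable_EFinP; apply: measurable_funM => //.
  by apply: measurable_funM; exact: measurableT_comp.
have g0 n t : (0 <= g n t)%E by rewrite lee_fin !mulr_ge0.
have ndw s : {homo (fun n => window n.+1%:R s : R) : a b / (a <= b)%N >-> a <= b}.
  by move=> a b ab; rewrite le_window// ler_nat.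
have cvw := @cvg_window R.
have ndg t : [set: plane R] t -> {homo g^~ t : a b / (a <= b)%N >-> (a <= b)%E}.
  move=> _ a b ab; rewrite lee_fin ler_wpM2r//.
  by rewrite ler_pM// ndw.
have lim_eq : (\int[mu2]_t limn (g^~ t) = \int[mu2]_t (e t)%:E)%E.
  apply: eq_integral => t _; apply/cvg_lim => //.
  apply: cvg_EFin; first exact: nearW.
  have e1 : e t = 1 * 1 * e t by rewrite !mul1r.
  rewrite [X in _ --> X]e1.
  by apply: cvgM; [apply: cvgM|exact: cvg_cst].
have h : (\int[mu2]_t g n t @[n --> \oo] --> \int[mu2]_t (e t)%:E)%E.
  rewrite -lim_eq.
  exact: (cvg_monotone_convergence measurableT mg (fun n t _ => g0 n t) ndg).
rewrite -(cvg_lim _ h)//; apply: lime_le; first by apply/cvg_ex; eexists; exact: h.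
apply: nearW => n.
apply: le_trans (bessel_window (_ : 0 < n.+1%:R)); last by [].
rewrite /Rintegral fineK//; apply: integrable_fin_num => //.
apply: (@integrable_mul_bounded _ _ _ mu2 _ e (2 * I ^+ 2)) => //.
exact: (integrable_prodM (integrable_window _) (integrable_window _)).
Qed.

End Bessel.

(** * Dilations of Lebesgue measure *)

Section Dilation.
Context {R : realType}.
Local Notation mu := (@lebesgue_measure R).

Lemma measurable_mull (t : R) :
  measurable_fun [set: measurableTypeR R] (fun x => t * x : measurableTypeR R).
Proof. exact: measurable_funM. Qed.

(** Both sides define measures that agree on half-open intervals. *)
Lemma integral_dilation (t : R) (F : R -> \bar R) : 0 < t ->
  measurable_fun [set: measurableTypeR R] F -> (forall x, 0 <= F x)%E ->
  (\int[mu]_x F x = t%:E * \int[mu]_x F (t * x)%R)%E.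
Proof.
move=> t0 mF F0.
pose phi (x : measurableTypeR R) : measurableTypeR R := t * x.
have mphi : measurable_fun setT phi := @measurable_mull t.
pose push : {measure set (measurableTypeR R) -> \bar R} :=
  measure_function_pushforward__canonical__measure_function_Measure mu mphi.
pose nu := mscale (NngNum (ltW t0)) push.
have nuE A : measurable A -> mu A = nu A.
  apply: lebesgue_measure_unique => //= _ [[a b]] _ <-.
  rewrite /nu /mscale /= /pushforward.
  have -> : phi @^-1` [set` `]a, b]%R] = [set` `]t^-1 * a, t^-1 * b]%R].
    apply/seteqP; split => x /=; rewrite !in_itv/= /phi;
      by rewrite ltr_pdivrMl// ler_pdivlMl.
  rewrite !lebesgue_measure_itv/= !lte_fin ltr_pM2l ?invr_gt0//.
  case: ifPn => _; last by rewrite mule0.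
  by rewrite -!EFinB -EFinM -mulrBr mulVKf// gt_eqF.
rewrite (eq_measure_integral nu) => [|A mA _]; last exact: nuE.
rewrite ge0_integral_mscale//= (ge0_integral_pushforward mphi)//.
Qed.

Lemma area_dilation (t : R) (F : plane R -> \bar R) : 0 < t ->
  measurable_fun setT F -> (forall x, 0 <= F x)%E ->
  (\int[area]_x F x = (t ^+ 2)%:E * \int[area]_x F (t * x.1, t * x.2)%R)%E.
Proof.
move=> t0 mF F0.
have mt := measurable_mull t.
pose Ft (x : plane R) := F (t * x.1, t * x.2).
have mFt : measurable_fun setT Ft.
  apply: (measurableT_comp mF); apply: measurable_fun_pair;
    by apply: (measurableT_comp mt).
have Ft0 x : (0 <= Ft x)%E by exact: F0.
change ((\int[mu \x mu]_x F x = (t ^+ 2)%:E * \int[mu \x mu]_x Ft x)%E).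
rewrite (fubini_tonelli1 F)// (fubini_tonelli1 Ft)// /fubini_F.
rewrite (integral_dilation t0); last 2 first.
- exact: (@measurable_fun_fubini_tonelli_F _ _ _ _ _ mu F).
- by move=> x; exact: integral_ge0.
rewrite expr2 EFinM -muleA; congr (_ * _)%E.
rewrite -ge0_integralZl//; last 3 first.
- by apply: (@measurable_fun_fubini_tonelli_F _ _ _ _ _ mu Ft) => // z; exact: F0.
- by move=> x _; apply: integral_ge0 => y _; exact: F0.
- exact: ltW.
apply: eq_integral => x _; rewrite (integral_dilation t0)//.
exact: (measurable_fun_pair2 (t * x) mF).
Qed.

End Dilation.

(** * Continuous functions on the plane and one-sided derivatives *)

Section PlaneMeasurability.
Context {R : realType}.

(** An open set is the union of the countably many rational boxes that it
contains. *)
Lemma open_plane_measurable (U : set (R * R)) : open U ->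
  measurable (U : set (plane R)).
Proof.
move=> oU.
pose box (i : rat * rat * (rat * rat)) : set (plane R) :=
  `]ratr i.1.1, ratr i.1.2[ `*` `]ratr i.2.1, ratr i.2.2[.
pose F i := if `[< box i `<=` U >] then box i else set0.
have -> : U = \bigcup_i F i.
  apply/seteqP; split=> [x Ux|x [i _]]; last by rewrite /F; case: asboolP => // h /h.
  have /nbhs_ballP[e /= e0 eU] := open_nbhs_nbhs (conj oU Ux).
  have [a /[!in_itv]/= /andP[ax1 ax2]] := @rat_in_itvoo R (x.1 - e) x.1 ltac:(by rewrite ltrBlDr ltrDl).
  have [b /[!in_itv]/= /andP[bx1 bx2]] := @rat_in_itvoo R x.1 (x.1 + e) ltac:(by rewrite ltrDl).
  have [c /[!in_itv]/= /andP[cx1 cx2]] := @rat_in_itvoo R (x.2 - e) x.2 ltac:(by rewrite ltrBlDr ltrDl).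
  have [d /[!in_itv]/= /andP[dx1 dx2]] := @rat_in_itvoo R x.2 (x.2 + e) ltac:(by rewrite ltrDl).
  exists (a, b, (c, d)) => //; rewrite /F ifT.
    by split; rewrite /= in_itv/= ?ax2 ?bx1 ?cx2 ?dx1.
  apply/asboolP => -[y1 y2] [/= ]; rewrite !in_itv/= => /andP[ay yb] /andP[cy yd].
  apply: eU; split; rewrite /ball/= ltr_distlC; apply/andP; split.
  - exact: lt_trans ax1 ay.
  - exact: lt_trans yb bx2.
  - exact: lt_trans cx1 cy.
  - exact: lt_trans yd dx2.
apply: countable_bigcupT_measurable => // i.
rewrite /F; case: ifP => _; last exact: measurable0.
by apply: measurableX; exact: measurable_itv.
Qed.

Lemma continuous_plane_measurable (f : R * R -> R) : continuous f ->
  measurable_fun [set: plane R] f.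
Proof.
move=> /continuousP cf; apply: (measurability _ (measurable_realfun.RGenOpens.measurableE R)).
move=> _ [_ [a [b ->] <-]]; rewrite setTI; apply: open_plane_measurable.
exact/cf/interval_open.
Qed.

End PlaneMeasurability.

Section DeriveWithin.
Context {R : realType}.
Variables (p q : R).
Local Notation D := (derive_within `[p, q]).

(** Near x the difference quotient is bounded by some M, so `|f y - f x| <= M
* `|y - x|. *)
Lemma continuous_of_derivable_within (f : R -> R) :
  (forall x, `[p, q]%classic x -> derivable_within `[p, q] f x) ->
  {within `[p, q], continuous f}.
Proof.
move=> df; apply/subspace_continuousP => x Ax.
have /cvg_ex[l] := df x Ax; set Q := (fun y => _) => /cvgr_norm_le Ql.
have Q1 : \forall y \near within `[p, q] x^', `|Q y| <= `|l| + 1.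
  by apply: Ql; rewrite ltrDl.
have M0 : 0 < `|l| + 1 by rewrite ltr_wpDl.
apply/cvgrPdist_lt => e e0.
have : \forall y \near x, y != x -> `[p, q]%classic y -> `|Q y| <= `|l| + 1.
  by move: Q1; rewrite /within/= /dnbhs/= /within/=.
move=> {}Q1; rewrite near_withinE; near=> y => Ay; change (`|f x - f y| < e).
have [->|yx] := eqVneq y x; first by rewrite subrr normr0.
have yx0 : y - x != 0 by rewrite subr_eq0.
have -> : f x - f y = - (Q y * (y - x)) by rewrite /Q mulfVK// opprB.
rewrite normrN normrM; apply: (@le_lt_trans _ _ ((`|l| + 1) * `|y - x|)).
  rewrite ler_wpM2r//; move: yx Ay; near: y; exact: Q1.
rewrite -ltr_pdivlMl// distrC; near: y.
by apply: nbhsx_ballx; rewrite mulr_gt0// invr_gt0.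
Unshelve. all: by end_near. Qed.

(** At an interior point the restriction to the interval does not change the
punctured neighbourhoods, so the one-sided notion is the usual derivative. *)
Lemma derive_within_interior (f : R -> R) x : x \in `]p, q[ ->
  derivable_within `[p, q] f x -> is_derive x 1 f (D f x).
Proof.
move=> xpq df.
have cQ : (fun y => (f y - f x) / (y - x)) @ x^' --> D f x.
  have : (fun y => (f y - f x) / (y - x)) @ within `[p, q] x^' --> D f x by exact: df.
  apply: cvg_trans; apply: cvg_app => A; rewrite /within /= => h.
  have xA : \forall y \near x, `[p, q]%classic y.
    apply: filterS (near_in_itvoo xpq) => y.
    by rewrite /= !in_itv/= => /andP[/ltW -> /ltW ->].
  near=> y; have : `[p, q]%classic y; last by near: y.
  by near: y; exact: nbhs_dnbhs.
have shiftx : (fun h => h + x) @ 0^' --> x^'.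
  move=> A /nbhs_ballP[e /= e0 eA]; apply/nbhs_ballP; exists e => //= h he h0.
  apply: eA; last by rewrite -subr_eq0 addrK.
  by move: he; rewrite /ball /= sub0r (_ : x - (h + x) = - h) //; ring.
have ch : h^-1 *: ((f \o shift x) (h *: 1) - f x) @[h --> 0^'] --> D f x.
  apply: cvg_trans (cvg_comp _ _ shiftx cQ); apply: near_eq_cvg.
  by apply: nearW => h /=; rewrite addrK [h *: 1]mulr1 [_ *: _]mulrC.
have dfx : derivable f x 1 by apply/cvg_ex; exists (D f x).
by split => //; exact: cvg_lim ch.
Unshelve. all: by end_near. Qed.

End DeriveWithin.

(** * Rays cross the curve transversally *)

Section Transversality.
Context {R : realType}.
Variables (p q : R) (psi : R -> R).
Hypotheses (ltpq : p < q) (psi_smooth : smooth_within `[p, q] psi).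
Hypothesis psi_neq0 : forall t : R, `[p, q]%classic t ->
  psi t - t * derive_within `[p, q] psi t != 0.
Local Notation D := (derive_within `[p, q]).

Lemma psi_within_continuous : {within `[p, q], continuous psi}.
Proof. apply: continuous_of_derivable_within => x; exact: (@psi_smooth 0%N x). Qed.

(** psi - t psi' is continuous and never 0 on a compact interval. *)
Lemma transversality_bound :
  exists2 c : R, 0 < c & forall s, s \in `[p, q] -> c <= `|psi s - s * D psi s|.
Proof.
have c1 : {within `[p, q], continuous (D psi)}.
  apply: continuous_of_derivable_within => x; exact: (@psi_smooth 1%N x).
have cT : {within `[p, q], continuous (fun s => `|psi s - s * D psi s|)}.
  apply/subspace_continuousP => x Ax.
  have /subspace_continuousP/(_ x Ax) cpsi := psi_within_continuous.
  move/subspace_continuousP : c1 => /(_ x Ax) cD.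
  apply: cvg_norm; apply: cvgB => //; apply: cvgM => //.
  exact: cvg_within_filter.
have [c cpq cmin] := EVT_min (ltW ltpq) cT.
exists `|psi c - c * D psi c|; last exact: cmin.
by rewrite normr_gt0; exact: psi_neq0.
Qed.

(** In the variable tau = 1 / t, the derivative of tau * psi (w / tau) is psi
s - s * psi' s at s = w / tau, and s stays in the open interval between the
two endpoints. The mean value theorem then applies. *)
Lemma slope_separation : exists2 c : R, 0 < c & forall w t1 t2 : R, 0 < t1 -> 0 < t2 ->
  t1 * w \in `]p, q[ -> t2 * w \in `]p, q[ ->
  c * `|t1^-1 - t2^-1| <= `|t1^-1 * psi (t1 * w) - t2^-1 * psi (t2 * w)|.
Proof.
have [c c0 cT] := transversality_bound; exists c => // w.
suff H (t1 t2 : R) : 0 < t1 -> 0 < t2 -> t2^-1 < t1^-1 ->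
    t1 * w \in `]p, q[ -> t2 * w \in `]p, q[ ->
    c * `|t1^-1 - t2^-1| <= `|t1^-1 * psi (t1 * w) - t2^-1 * psi (t2 * w)|.
  move=> t1 t2 t10 t20 i1 i2; have [lt|lt|/invr_inj ->] := ltgtP t1^-1 t2^-1.
  - by rewrite distrC [leRHS]distrC; exact: H.
  - exact: H.
  - by rewrite !subrr normr0 mulr0.
move=> t10 t20 lt12 i1 i2.
pose G (tau : R) : R := tau * psi (w * tau^-1).
(* w / tau lies between t1 * w and t2 * w. *)
have inside (tau : R) : t2^-1 <= tau <= t1^-1 -> w * tau^-1 \in `]p, q[.
  move=> /andP[l u].
  have tau0 : 0 < tau by rewrite (lt_le_trans _ l)// invr_gt0.
  have l' : tau^-1 <= t2 by rewrite -[leRHS]invrK lef_pV2// posrE invr_gt0.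
  have u' : t1 <= tau^-1 by rewrite -[leLHS]invrK lef_pV2// posrE invr_gt0.
  move: i1 i2; rewrite !in_itv/= => /andP[a1 b1] /andP[a2 b2].
  have [w0|w0] := leP 0 w; apply/andP; split.
  - by apply: (lt_le_trans a1); rewrite mulrC ler_wpM2l.
  - by apply: le_lt_trans b2; rewrite mulrC ler_wpM2r.
  - by apply: (lt_le_trans a2); rewrite mulrC ler_wnM2l// ltW.
  - by apply: le_lt_trans b1; rewrite mulrC ler_wnM2r// ltW.
have dG tau : t2^-1 <= tau <= t1^-1 ->
    is_derive tau 1 G (psi (w * tau^-1) - (w * tau^-1) * D psi (w * tau^-1)).
  move=> tauI; have ti := inside _ tauI.
  have tau0 : tau != 0.
    by case/andP: tauI => l _; rewrite gt_eqF// (lt_le_trans _ l)// invr_gt0.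
  have di : is_derive tau 1 (fun s : R => s^-1) (- tau ^- 2).
    by apply: (is_derive_eq (is_deriveV tau0 (is_derive_id tau (1 : R)))); rewrite /= [_ *: _]mulr1.
  have dpsi : is_derive (w * tau^-1) 1 psi (D psi (w * tau^-1)).
    apply: derive_within_interior => //; apply: (@psi_smooth 0%N).
    by move: ti; rewrite /= !in_itv/= => /andP[/ltW -> /ltW ->].
  have dg : is_derive tau 1 (fun s : R => w * s^-1) (w * (- tau ^- 2)) := is_derive_mull w di.
  have dc := is_derive_mulf (is_derive_id tau (1 : R)) (@is_derive1_comp _ psi (fun s => w * s^-1) tau _ _ dpsi dg).
  by apply: (is_derive_eq dc); rewrite /=; field.
have cG : {within `[t2^-1, t1^-1], continuous G}.
  apply: continuous_in_subspaceT => x; rewrite inE/= in_itv/= => xI.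
  exact: is_derive_continuous (dG x xI).
have dG' x : x \in `]t2^-1, t1^-1[ -> is_derive x 1 G
    (psi (w * x^-1) - (w * x^-1) * D psi (w * x^-1)).
  by rewrite in_itv/= => /andP[/ltW l /ltW u]; apply: dG; rewrite l.
have [tau tauI] := MVT lt12 dG' cG.
have -> : G t1^-1 - G t2^-1 = t1^-1 * psi (t1 * w) - t2^-1 * psi (t2 * w).
  by rewrite /G !invrK !(mulrC w).
move=> ->; rewrite normrM ler_wpM2r//; apply: cT.
have : w * tau^-1 \in `]p, q[.
  by apply: inside; move: tauI; rewrite in_itv/= => /andP[/ltW -> /ltW ->].
by rewrite !in_itv/= => /andP[/ltW -> /ltW ->].
Qed.

(** A point t * w lies within delta of the curve exactly when (psi (t * w.1))
/ t is within delta / t of w.2. Two such t give two nearby values, which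
slope_separation turns into nearby values of 1 / t. *)
Lemma scaling_times_close : exists2 c : R, 0 < c & forall (w : R * R) (delta t1 t2 : R),
  0 < t1 -> 0 < t2 -> t1 * w.1 \in `]p, q[ -> t2 * w.1 \in `]p, q[ ->
  `|t1 * w.2 - psi (t1 * w.1)| <= delta -> `|t2 * w.2 - psi (t2 * w.1)| <= delta ->
  c * `|t2 - t1| <= delta * (t1 + t2).
Proof.
have [c c0 sep] := slope_separation; exists c => // w delta t1 t2 t10 t20 i1 i2 h1 h2.
have near t : 0 < t -> `|t * w.2 - psi (t * w.1)| <= delta ->
    `|t^-1 * psi (t * w.1) - w.2| <= delta * t^-1.
  move=> t0 h; have -> : t^-1 * psi (t * w.1) - w.2 = - (t * w.2 - psi (t * w.1)) * t^-1.
    by field; rewrite gt_eqF.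
  by rewrite normrM normrN (gtr0_norm (_ : 0 < t^-1)) ?invr_gt0// ler_wpM2r// invr_ge0 ltW.
have := sep _ _ _ t10 t20 i1 i2.
have := ler_normB (t1^-1 * psi (t1 * w.1) - w.2) (t2^-1 * psi (t2 * w.1) - w.2).
rewrite opprB addrA subrK => tri lo.
have {lo tri} : c * `|t1^-1 - t2^-1| <= delta * (t1^-1 + t2^-1).
  apply: (le_trans lo); apply: (le_trans tri).
  by rewrite mulrDr lerD// near.
have -> : t1^-1 - t2^-1 = (t2 - t1) * (t1 * t2)^-1 by field; rewrite !gt_eqF.
have -> : t1^-1 + t2^-1 = (t1 + t2) * (t1 * t2)^-1 by field; rewrite !gt_eqF.
have tt0 : 0 < (t1 * t2)^-1 by rewrite invr_gt0 mulr_gt0.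
by rewrite normrM (gtr0_norm tt0) !mulrA ler_pM2r.
Qed.

End Transversality.

Section SmallSupport.
Context {R : realType}.
Local Notation mu := (@lebesgue_measure R).

(** The support is contained in an interval of radius d around any one of its
points. *)
Lemma integral_clustered_support (h : R -> R) (H d : R) : 0 <= H -> 0 <= d ->
  measurable_fun [set: R] h -> (forall t, 0 <= h t <= H) ->
  (forall t1 t2, h t1 != 0 -> h t2 != 0 -> `|t2 - t1| <= d) ->
  (\int[mu]_t (h t)%:E <= (H * (2 * d))%:E)%E.
Proof.
move=> H0 d0 mh hH hd.
have [[t0 ht0]|nh] := pselect (exists t, h t != 0); last first.
  rewrite integral0_eq ?lee_fin ?mulr_ge0// => x _; congr EFin.
  by apply/eqP; apply/negP => /negP hx; apply: nh; exists x.
apply: (@le_trans _ _ (\int[mu]_t (H * \1_(`[t0 - d, t0 + d]) t)%:E)%E).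
  apply: ge0_le_integral => //.
  - by move=> t _; rewrite lee_fin; case/andP: (hH t).
  - exact/measurable_EFinP.
  - by apply/measurable_EFinP/measurable_funM => //; exact: measurable_indic.
  move=> t _; rewrite lee_fin; have [->|ht] := eqVneq (h t) 0.
    by rewrite mulr_ge0// indicE.
  rewrite indicE mem_set ?mulr1; first by case/andP: (hH t).
  by rewrite /= in_itv/= -ler_distl hd.
under eq_integral do rewrite EFinM.
rewrite ge0_integralZl//; last by apply/measurable_EFinP; exact: measurable_indic.
rewrite integral_indic// setIT EFinM lee_wpmul2l ?lee_fin//.
rewrite [leLHS]lebesgue_measure_itv/= lte_fin.
case: ifPn => _; last by rewrite lee_fin mulr_ge0.
by rewrite -?EFinN -?EFinD lee_fin; lra.
Qed.

End SmallSupport.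

(** * Complex-valued functions and the localized multiplier *)

Local Notation normc := ComplexField.Normc.normc.

(** The inverse is continuous away from 0. *)
Lemma measurable_invr (R : realType) : measurable_fun [set: R] (@GRing.inv R).
Proof.
rewrite -(setUv [set (0 : R)]); apply/measurable_funU => //.
  by apply: measurableC.
split; first exact: measurable_fun_set1.
apply: open_continuous_measurable_fun; first by apply: closed_openC; exact: closed_eq.
by move=> x /[!inE]/= /eqP x0; exact: inv_continuous.
Qed.

Section ComplexModulus.
Context {R : realType}.
Implicit Types z w : R[i].

Lemma normc_sqrE z : normc z ^+ 2 = complex.Re z ^+ 2 + complex.Im z ^+ 2.
Proof. by case: z => x y /=; rewrite sqr_sqrtr// addr_ge0 ?sqr_ge0. Qed.

Lemma normc_ge0 z : 0 <= normc z.
Proof. by case: z => x y; exact: sqrtr_ge0. Qed.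

Lemma normc_le z (B : R) : 0 <= B ->
  complex.Re z ^+ 2 + complex.Im z ^+ 2 <= B ^+ 2 -> normc z <= B.
Proof.
by move=> B0; rewrite -normc_sqrE ler_pXn2r// nnegrE normc_ge0.
Qed.

Lemma normr_Re_le z : `|complex.Re z| <= normc z.
Proof.
rewrite -(@ler_pXn2r _ 2)// ?nnegrE ?normc_ge0// normc_sqrE real_normK ?num_real//.
by rewrite lerDl sqr_ge0.
Qed.

Lemma normr_Im_le z : `|complex.Im z| <= normc z.
Proof.
rewrite -(@ler_pXn2r _ 2)// ?nnegrE ?normc_ge0// normc_sqrE real_normK ?num_real//.
by rewrite lerDr sqr_ge0.
Qed.

Lemma normc_leD z : normc z <= `|complex.Re z| + `|complex.Im z|.
Proof.
apply: normc_le; first exact: addr_ge0.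
rewrite sqrrD !real_normK ?num_real// addrAC lerDl.
by rewrite mulrn_wge0 ?mulr_ge0.
Qed.

End ComplexModulus.

Section ComplexMeasurability.
Context d (T : measurableType d) {R : realType}.
Implicit Types f g : T -> R[i].

Definition cmeasurable f := measurable_fun setT (fun x => complex.Re (f x)) /\
  measurable_fun setT (fun x => complex.Im (f x)).

Lemma cmeasurableM f g : cmeasurable f -> cmeasurable g ->
  cmeasurable (fun x => f x * g x).
Proof.
move=> [rf jf] [rg jg]; split.
- rewrite (_ : (fun x => _) = (fun x => complex.Re (f x) * complex.Re (g x) -
    complex.Im (f x) * complex.Im (g x))); last first.
    by apply/funext => x; case: (f x) => ? ?; case: (g x).
  by apply: measurable_funB; apply: measurable_funM.
- rewrite (_ : (fun x => _) = (fun x => complex.Re (f x) * complex.Im (g x) +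
    complex.Im (f x) * complex.Re (g x))); last first.
    by apply/funext => x; case: (f x) => ? ?; case: (g x).
  by apply: measurable_funD; apply: measurable_funM.
Qed.

Lemma measurable_sqr_normc f : cmeasurable f ->
  measurable_fun setT (fun x => normc (f x) ^+ 2).
Proof.
move=> [rf jf]; under eq_fun do rewrite normc_sqrE.
by apply: measurable_funD; exact: measurable_funX.
Qed.

Lemma measurable_normc f : cmeasurable f -> measurable_fun setT (fun x => normc (f x)).
Proof.
move=> mf; rewrite (_ : (fun x => _) = (fun x => Num.sqrt (normc (f x) ^+ 2))).
  by apply: measurableT_comp; [apply: continuous_measurable_fun; exact: sqrt_continuous|exact: measurable_sqr_normc].
by apply/funext => x; rewrite sqrtr_sqr ger0_norm// normc_ge0.
Qed.

End ComplexMeasurability.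

Lemma cmeasurable_comp d1 d2 (T1 : measurableType d1) (T2 : measurableType d2)
    (R : realType) (f : T2 -> R[i]) (g : T1 -> T2) :
  cmeasurable f -> measurable_fun setT g -> cmeasurable (fun x => f (g x)).
Proof. by move=> [rf jf] mg; split; [exact: (measurableT_comp rf mg)|exact: (measurableT_comp jf mg)]. Qed.

Section CompactSupport.
Context {R : realType}.

Lemma continuous_compact_bounded (T : topologicalType) (f : T -> R) (A : set T) :
  continuous f -> compact A -> exists B, forall x, A x -> `|f x| <= B.
Proof.
move=> cf cA.
have : compact [set f x | x in A].
  by apply: continuous_compact => //; exact: continuous_subspaceT.
move=> /compact_bounded[M [_ hM]]; exists (M + 1) => x Ax.
by apply: (hM (M + 1)); [rewrite ltrDl|exists x].
Qed.

Lemma compact_support_bounded (T : topologicalType) (f : T -> R[i]) :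
  continuous (fun x => complex.Re (f x)) -> continuous (fun x => complex.Im (f x)) ->
  compact (supp f) -> exists2 B, 0 <= B & forall x, normc (f x) <= B.
Proof.
move=> cr ci cs.
have [B1 h1] := continuous_compact_bounded cr cs.
have [B2 h2] := continuous_compact_bounded ci cs.
have B0 : 0 <= `|B1| + `|B2| by exact: addr_ge0.
exists (`|B1| + `|B2|) => // x; have [->|fx] := eqVneq (f x) 0.
  by rewrite ComplexField.Normc.normc0.
have sx : supp f x by exact: subset_closure.
apply: (le_trans (normc_leD _)); apply: lerD.
- exact: le_trans (h1 x sx) (ler_norm _).
- exact: le_trans (h2 x sx) (ler_norm _).
Qed.

Lemma smooth2_continuous (f : R * R -> R[i]) : smooth2 f ->
  continuous (fun x => complex.Re (f x)) /\ continuous (fun x => complex.Im (f x)).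
Proof. by move=> [/(_ [::])[rf _] /(_ [::])[jf _]]. Qed.

Lemma smooth1_continuous (f : R -> R[i]) : smooth1 f ->
  continuous (fun x => complex.Re (f x)) /\ continuous (fun x => complex.Im (f x)).
Proof.
move=> sf; split => x; apply/differentiable_continuous/derivable1_diffP;
  by have [] := sf 0%N x.
Qed.

Lemma smooth2_cmeasurable (f : R * R -> R[i]) : smooth2 f ->
  cmeasurable (f : plane R -> R[i]).
Proof. by move=> /smooth2_continuous[rf jf]; split; exact: continuous_plane_measurable. Qed.

Lemma smooth1_cmeasurable (f : R -> R[i]) : smooth1 f ->
  cmeasurable (f : measurableTypeR R -> R[i]).
Proof. by move=> /smooth1_continuous[rf jf]; split; exact: continuous_measurable_fun. Qed.

End CompactSupport.

Section Multiplier.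
Context {R : realType}.
Local Notation mu := (@lebesgue_measure R).
Variables (p q : R) (psi : R -> R) (b : R * R -> R[i]).
Hypothesis psi_smooth : smooth_within `[p, q] psi.
Hypotheses (b_C0oo : C0oo2 b) (b_supp : supp b `<=` interior `[p, q] `*` [set: R]).
Hypothesis b_near0 : \forall xi \near (0 : R * R), b xi = 0.

Lemma b_bounded : exists2 B, 0 <= B & forall xi, normc (b xi) <= B.
Proof.
have [sb cb] := b_C0oo; have [rb jb] := smooth2_continuous sb.
exact: compact_support_bounded.
Qed.

Lemma b_annulus : exists r M : R, [/\ 0 < r, 0 < M &
  forall xi, b xi != 0 -> r <= `|xi| <= M].
Proof.
have /nbhs_ballP[r /= r0 hr] := b_near0.
have [M [_ hM]] := compact_bounded b_C0oo.2.
exists r, (`|M| + 1); split=> //.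
move=> xi bxi; apply/andP; split.
  rewrite leNgt; apply: contra bxi => lt; apply/eqP/hr.
  by rewrite -ball_normE /ball_ /= sub0r normrN.
apply: (hM (`|M| + 1)); first by rewrite ltr_pwDr// ler_norm.
exact: subset_closure.
Qed.

Lemma b_strip xi : b xi != 0 -> xi.1 \in `]p, q[.
Proof.
move=> bxi; have [] : (interior `[p, q] `*` [set: R]) xi.
  by apply: b_supp; exact: subset_closure.
by rewrite interior_itv.
Qed.

Variables (Phi : R -> R[i]) (delta S : R).
Hypotheses (Phi_smooth : smooth1 Phi) (Phi_supp : supp Phi `<=` `[-1, 1]).
Hypotheses (delta0 : 0 < delta) (PhiS : forall s, normc (Phi s) <= S).
Local Notation phi := (phi_delta b Phi psi delta).

(** Outside the interval psi is arbitrary, but b vanishes there, so psi may be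
replaced by its restriction extended by 0, which is measurable. *)
Lemma phi_cmeasurable : cmeasurable (phi : plane R -> R[i]).
Proof.
pose psi' := psi \_ `[p, q].
have mpsi : measurable_fun [set: R] psi'.
  apply/measurable_restrict => //; rewrite setTI.
  apply: subspace_continuous_measurable_fun => //.
  exact: psi_within_continuous psi_smooth.
have -> : phi = fun xi : plane R => b xi * Phi (delta^-1 * (xi.2 - psi' xi.1)).
  apply/funext => xi; rewrite /phi_delta; have [->|bxi] := eqVneq (b xi) 0.
    by rewrite !mul0r.
  rewrite /psi' patchE mem_set//=; have := b_strip bxi.
  by rewrite !in_itv/= => /andP[/ltW -> /ltW ->].
apply: cmeasurableM; first exact: (smooth2_cmeasurable b_C0oo.1).
apply: (cmeasurable_comp (smooth1_cmeasurable Phi_smooth)).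
apply: measurable_funM => //; apply: measurable_funB => //.
by apply: (measurableT_comp mpsi).
Qed.

Lemma phi_near_curve xi : phi xi != 0 -> b xi != 0 /\ `|xi.2 - psi xi.1| <= delta.
Proof.
rewrite /phi_delta mulf_eq0 negb_or => /andP[bxi Phixi]; split => //.
have : `[-1, 1]%classic (delta^-1 * (xi.2 - psi xi.1)).
  by apply: Phi_supp; exact: subset_closure.
rewrite /= in_itv/= -ler_norml normrM gtr0_norm ?invr_gt0//.
by rewrite ler_pdivrMl// mulr1.
Qed.

End Multiplier.

(** * The multiplier along rays *)

Section MultiplierBound.
Context {R : realType}.
Local Notation mu := (@lebesgue_measure R).
Variables (p q : R) (psi : R -> R) (b : R * R -> R[i]).
Hypotheses (ltpq : p < q) (psi_smooth : smooth_within `[p, q] psi).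
Hypothesis psi_neq0 : forall t : R, `[p, q]%classic t ->
  psi t - t * derive_within `[p, q] psi t != 0.
Hypotheses (b_C0oo : C0oo2 b) (b_supp : supp b `<=` interior `[p, q] `*` [set: R]).
Hypothesis b_near0 : \forall xi \near (0 : R * R), b xi = 0.

(** For fixed w all admissible t satisfy r <= t * n <= M with n = `|w|, so
scaling_times_close puts any two of them within 2 * delta * M / (c * n) of
each other, while 1 / t <= n / r. The powers of n cancel, which makes the
bound uniform in w. *)
Lemma multiplier_bound : exists2 K, 0 <= K &
  forall (Phi : R -> R[i]) (delta S : R), smooth1 Phi -> supp Phi `<=` `[-1, 1] ->
  0 < delta -> (forall s, normc (Phi s) <= S) ->
  forall w : plane R,
  (\int[mu]_(t in `]0%R, +oo[)
     (normc (phi_delta b Phi psi delta (t * w.1, t * w.2)) ^+ 2 / t)%:E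
   <= (K * (delta * S ^+ 2))%:E)%E.
Proof.
have [c c0 close] := scaling_times_close ltpq psi_smooth psi_neq0.
have [B B0 bB] := b_bounded b_C0oo.
have [r [M [r0 M0 brM]]] := b_annulus b_C0oo b_near0.
(* Height B ^ 2 * S ^ 2 * n / r times twice the diameter 2 * delta * M / (c * n). *)
exists (4 * B ^+ 2 * M / (c * r)).
  by rewrite divr_ge0 ?mulr_ge0 ?sqr_ge0// ?ltW// mulr_gt0.
move=> Phi delta S sPhi supPhi delta0 PhiS w.
set phi := phi_delta b Phi psi delta.
have S0 : 0 <= S by exact: le_trans (normc_ge0 _) (PhiS 0).
have mphi : cmeasurable (phi : plane R -> R[i]).
  exact: (phi_cmeasurable psi_smooth b_C0oo b_supp).
pose n := `|w : R * R|.
have nE t : 0 < t -> `|(t * w.1, t * w.2) : R * R| = t * n.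
  move=> t0; have -> : (t * w.1, t * w.2) = t *: (w : R * R) by [].
  by rewrite normrZ gtr0_norm.
pose h t := if 0 < t then normc (phi (t * w.1, t * w.2)) ^+ 2 / t else 0.
have -> : (\int[mu]_(t in `]0%R, +oo[) (normc (phi (t * w.1, t * w.2)) ^+ 2 / t)%:E =
    \int[mu]_t (h t)%:E)%E.
  rewrite integral_mkcond; apply: eq_integral => t _.
  by rewrite /h patchE mem_setE in_itv/= andbT; case: ifP.
have mh : measurable_fun [set: R] h.
  apply: measurable_fun_if => //.
  - apply: (measurable_fun_bool true) => //=; rewrite setTI (_ : _ @^-1` _ = `]0, +oo[%classic)//.
    by apply/seteqP; split => t /=; rewrite in_itv/= andbT.
  - apply: measurable_funTS; apply: measurable_funM.
      apply: measurable_sqr_normc; apply: (cmeasurable_comp mphi).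
      by apply: measurable_fun_pair; apply: measurable_funM.
    exact: measurable_invr.
have hneq t : h t != 0 -> [/\ 0 < t, r <= t * n <= M,
    t * w.1 \in `]p, q[ & (`|t * w.2 - psi (t * w.1)| <= delta)].
  rewrite /h; case: ifPn => [t0|]; last by rewrite eqxx.
  move=> ht; have /(phi_near_curve supPhi delta0)[bn cl] : phi (t * w.1, t * w.2) != 0.
    by apply: contraNneq ht => ->; rewrite ComplexField.Normc.normc0 expr0n mul0r.
  split=> //; first by rewrite -nE// brM.
  exact: (b_strip b_supp bn).
have phiB xi : normc (phi xi) ^+ 2 <= B ^+ 2 * S ^+ 2.
  rewrite -exprMn lerXn2r ?nnegrE ?mulr_ge0 ?normc_ge0//.
  by rewrite /phi /phi_delta ComplexField.Normc.normcM ler_pM ?normc_ge0.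
(* The ray through w = 0 stays at the origin, where b vanishes. *)
have [n0|n0] := eqVneq n 0.
  rewrite integral0_eq => [|t _].
    rewrite lee_fin; apply: mulr_ge0; last by rewrite mulr_ge0 ?sqr_ge0 ?ltW.
    by rewrite divr_ge0 ?mulr_ge0 ?sqr_ge0// ?ltW// mulr_gt0.
  congr EFin; apply/eqP/negP => /negP/hneq[_ /andP[+ _] _ _].
  by rewrite n0 mulr0 leNgt r0.
have {}n0 : 0 < n by rewrite lt_neqAle eq_sym n0 normr_ge0.
have -> : 4 * B ^+ 2 * M / (c * r) * (delta * S ^+ 2) =
    B ^+ 2 * S ^+ 2 * (n / r) * (2 * (2 * delta * M / (c * n))).
  by field; rewrite !gt_eqF.
apply: integral_clustered_support => //.
- by rewrite !mulr_ge0 ?sqr_ge0 ?invr_ge0// ltW.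
- by rewrite divr_ge0 ?mulr_ge0// ltW// mulr_gt0.
- move=> t; have [->|ht] := eqVneq (h t) 0.
    by rewrite lexx !mulr_ge0 ?sqr_ge0 ?invr_ge0// ltW.
  have [t0 /andP[rt _] _ _] := hneq _ ht.
  rewrite /h t0 divr_ge0 ?sqr_ge0 ?(ltW t0)//= ler_pM ?sqr_ge0 ?invr_ge0 ?(ltW t0)//.
  by rewrite -[leRHS]invf_div lef_pV2 ?posrE ?divr_gt0// ler_pdivrMr.
- move=> t1 t2 h1 h2.
  have [t10 /andP[_ t1M] i1 c1] := hneq _ h1.
  have [t20 /andP[_ t2M] i2 c2] := hneq _ h2.
  rewrite ler_pdivlMr ?mulr_gt0//.
  have sep := close w delta t1 t2 t10 t20 i1 i2 c1 c2.
  have -> : `|t2 - t1| * (c * n) = n * (c * `|t2 - t1|) by ring.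
  apply: (@le_trans _ _ (n * (delta * (t1 + t2)))); first by rewrite ler_pM2l.
  have -> : n * (delta * (t1 + t2)) = delta * (t1 * n + t2 * n) by ring.
  have -> : 2 * delta * M = delta * (M + M) by ring.
  by rewrite ler_pM2l// lerD.
Qed.

End MultiplierBound.

(** * The Fourier transform of complex functions *)

Section ComplexTransform.
Context {R : realType}.
Implicit Types (f g : plane R -> R[i]) (c : R).

Definition cintegrable g := (@area R).-integrable setT (fun x => (complex.Re (g x))%:E) /\
  (@area R).-integrable setT (fun x => (complex.Im (g x))%:E).

Lemma cintegrable_cmeasurable g : cintegrable g -> cmeasurable g.
Proof.
move=> [rg jg]; split; apply/measurable_EFinP.
  exact: (measurable_int area rg).
exact: (measurable_int area jg).
Qed.

Lemma cintegrable_dominated g (h : plane R -> R) : cmeasurable g ->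
  (@area R).-integrable setT (EFin \o h) -> (forall x, normc (g x) <= `|h x|) ->
  cintegrable g.
Proof.
move=> [rg jg] ih gh; split.
- apply: (@le_integrable _ _ _ area _ measurableT _ (EFin \o h)) => //.
    exact/measurable_EFinP.
  by move=> x _; rewrite /= lee_fin (le_trans (normr_Re_le _)).
- apply: (@le_integrable _ _ _ area _ measurableT _ (EFin \o h)) => //.
    exact/measurable_EFinP.
  by move=> x _; rewrite /= lee_fin (le_trans (normr_Im_le _)).
Qed.

Lemma cintegrable_normc g : cintegrable g ->
  (@area R).-integrable setT (EFin \o (fun x => normc (g x))).
Proof.
move=> ig; have mg := cintegrable_cmeasurable ig; case: ig => rg jg.
apply: (@le_integrable _ _ _ area _ measurableT _
  (fun x => (`|complex.Re (g x)| + `|complex.Im (g x)|)%:E)).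
- by apply/measurable_EFinP; exact: measurable_normc.
- move=> x _; rewrite /= lee_fin ger0_norm ?normc_ge0// [leRHS]ger0_norm ?addr_ge0//.
  exact: normc_leD.
- by have := integrableD measurableT (integrable_abse rg) (integrable_abse jg); apply: eq_integrable.
Qed.

Lemma cintegral2Zl (a : R[i]) g : cintegrable g ->
  cintegral2 (fun x => a * g x) = a * cintegral2 g.
Proof.
move=> [rg jg]; case: a => a1 a2; rewrite /cintegral2.
have e1 : \int[leb2 R]_x complex.Re ((a1 +i* a2) * g x) =
    \int[leb2 R]_x (a1 * complex.Re (g x) - a2 * complex.Im (g x)).
  by apply: eq_Rintegral => x _; case: (g x).
have e2 : \int[leb2 R]_x complex.Im ((a1 +i* a2) * g x) =
    \int[leb2 R]_x (a1 * complex.Im (g x) + a2 * complex.Re (g x)).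
  by apply: eq_Rintegral => x _; case: (g x).
rewrite e1 e2 RintegralB//; [|exact: (integrableZl measurableT _ rg)|exact: (integrableZl measurableT _ jg)].
rewrite RintegralD//; [|exact: (integrableZl measurableT _ jg)|exact: (integrableZl measurableT _ rg)].
by rewrite !RintegralZl.
Qed.

Lemma eq_cintegral2 f g : f =1 g -> cintegral2 f = cintegral2 g.
Proof. by move=> fg; congr cintegral2; apply/funext. Qed.

Lemma cintegral2_swap (G : plane R * plane R -> R[i]) (al be : plane R -> R) :
  cmeasurable G -> (@area R).-integrable setT (EFin \o al) ->
  (@area R).-integrable setT (EFin \o be) ->
  (forall x y, normc (G (x, y)) <= `|al x| * `|be y|) ->
  cintegral2 (fun x => cintegral2 (fun y => G (x, y))) =
  cintegral2 (fun y => cintegral2 (fun x => G (x, y))).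
Proof.
move=> [rG jG] ial ibe dG; rewrite /cintegral2 /=; congr (_ +i* _).
- apply: (@dominated_Rintegral_swap _ _ _ _ R area area _ al be rG ial ibe).
  by move=> x y; exact: le_trans (normr_Re_le _) (dG x y).
- apply: (@dominated_Rintegral_swap _ _ _ _ R area area _ al be jG ial ibe).
  by move=> x y; exact: le_trans (normr_Im_le _) (dG x y).
Qed.

Lemma expiD (s t : R) : expi (s + t) = expi s * expi t.
Proof. by rewrite /expi cosD sinD; congr (_ +i* _); ring. Qed.

Lemma normc_expi (s : R) : normc (expi s) = 1.
Proof. by rewrite /= cos2Dsin2 sqrtr1. Qed.

Lemma cmeasurable_expi d (T : measurableType d) (h : T -> R) :
  measurable_fun setT h -> cmeasurable (fun x => expi (h x)).
Proof.
move=> mh; split.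
- by apply: (measurableT_comp _ mh); apply: continuous_measurable_fun; exact: continuous_cos.
- by apply: (measurableT_comp _ mh); apply: continuous_measurable_fun; exact: continuous_sin.
Qed.

(** The inverse Fourier transform is the case c = 2 * pi and the Fourier
transform the case c = - (2 * pi); other values of c absorb dilations. *)
Definition exp_transform c g (xi : plane R) : R[i] :=
  cintegral2 (fun x => g x * expi (c * dot x xi)).

Lemma cintegrable_exp c g xi : cintegrable g -> cintegrable (fun x => g x * expi (c * dot x xi)).
Proof.
move=> ig; apply: (cintegrable_dominated _ (cintegrable_normc ig)).
- apply: cmeasurableM; first exact: cintegrable_cmeasurable.
  apply: cmeasurable_expi; exact: (measurable_fun_pair1 xi (measurable_phase c)).
- by move=> x; rewrite ComplexField.Normc.normcM normc_expi mulr1 ger0_norm ?normc_ge0.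
Qed.

(** Reduces the complex transform to the four real transforms of the real and
imaginary parts. *)
Lemma exp_transformE c g xi : cintegrable g ->
  exp_transform c g xi =
  (cos_transform area (phase c) (fun x => complex.Re (g x)) xi -
   sin_transform area (phase c) (fun x => complex.Im (g x)) xi) +i*
  (sin_transform area (phase c) (fun x => complex.Re (g x)) xi +
   cos_transform area (phase c) (fun x => complex.Im (g x)) xi).
Proof.
move=> [rg jg]; rewrite /exp_transform /cintegral2.
have mc : measurable_fun setT (fun x : plane R => cos (phase c (x, xi))).
  exact: (cmeasurable_expi (measurable_fun_pair1 xi (measurable_phase c))).1.
have ms : measurable_fun setT (fun x : plane R => sin (phase c (x, xi))).
  exact: (cmeasurable_expi (measurable_fun_pair1 xi (measurable_phase c))).2.
have bc (x : plane R) : `|cos (phase c (x, xi))| <= 1 by rewrite ler_norml cos_geN1 cos_le1.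
have bs (x : plane R) : `|sin (phase c (x, xi))| <= 1 by rewrite ler_norml sin_geN1 sin_le1.
rewrite /cos_transform /sin_transform.
rewrite -RintegralB//; [|exact: (integrable_mul_bounded rg mc bc)|exact: (integrable_mul_bounded jg ms bs)].
rewrite -RintegralD//; [|exact: (integrable_mul_bounded rg ms bs)|exact: (integrable_mul_bounded jg mc bc)].
by congr (_ +i* _); apply: eq_Rintegral => x _; case: (g x) => ? ? /=; rewrite ?mulrN.
Qed.

Lemma cmeasurable_exp_transform c g : cintegrable g -> cmeasurable (exp_transform c g).
Proof.
move=> ig; have [rg jg] := ig.
have mC := measurable_cos_transform (measurable_phase c).
have mS := measurable_sin_transform (measurable_phase c).
rewrite (_ : exp_transform c g = fun xi =>
  (cos_transform area (phase c) (fun x => complex.Re (g x)) xi -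
   sin_transform area (phase c) (fun x => complex.Im (g x)) xi) +i*
  (sin_transform area (phase c) (fun x => complex.Re (g x)) xi +
   cos_transform area (phase c) (fun x => complex.Im (g x)) xi)).
  by split; [apply: measurable_funB|apply: measurable_funD]; [exact: mC|exact: mS|exact: mS|exact: mC].
by apply/funext => xi; exact: exp_transformE.
Qed.

Lemma exp_transform_bounded c g : cintegrable g ->
  exists2 B, 0 <= B & forall xi, normc (exp_transform c g xi) <= B.
Proof.
move=> ig; have [rg jg] := ig.
pose U := \int[area]_x `|complex.Re (g x)|; pose V := \int[area]_x `|complex.Im (g x)|.
have U0 : 0 <= U by exact: Rintegral_ge0.
have V0 : 0 <= V by exact: Rintegral_ge0.
exists ((U + V) + (U + V)) => [|xi]; first by rewrite !addr_ge0.
rewrite exp_transformE//.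
have [Cu Su] := norm_transforms_le (measurable_phase c) rg xi.
have [Cv Sv] := norm_transforms_le (measurable_phase c) jg xi.
apply: (le_trans (normc_leD _)) => /=.
apply: (le_trans (lerD (ler_normB _ _) (ler_normD _ _))).
by rewrite !lerD.
Qed.

Let sum_sqr_le (a b d e : R) :
  (a - d) ^+ 2 + (b + e) ^+ 2 <= 2 * (a ^+ 2 + b ^+ 2 + (e ^+ 2 + d ^+ 2)).
Proof. by have := sqr_ge0 (a + d); have := sqr_ge0 (b - e); nra. Qed.

(** The real and imaginary parts are each a combination of two real
transforms; the factor 2 comes from (a - d) ^+ 2 <= 2 * (a ^+ 2 + d ^+ 2). *)
Lemma cbessel c g : c != 0 -> cintegrable g ->
  (\int[area]_xi (normc (exp_transform c g xi) ^+ 2)%:E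
   <= (2 * (16 * pi / `|c|) ^+ 2)%:E * \int[area]_x (normc (g x) ^+ 2)%:E)%E.
Proof.
move=> c0 ig; have [rg jg] := ig; have mg := cintegrable_cmeasurable ig.
have [mrg mjg] := mg.
pose u x := complex.Re (g x); pose v x := complex.Im (g x).
pose Cu := cos_transform area (phase c) u; pose Su := sin_transform area (phase c) u.
pose Cv := cos_transform area (phase c) v; pose Sv := sin_transform area (phase c) v.
have mCu : measurable_fun setT Cu := measurable_cos_transform (measurable_phase c) rg.
have mSu : measurable_fun setT Su := measurable_sin_transform (measurable_phase c) rg.
have mCv : measurable_fun setT Cv := measurable_cos_transform (measurable_phase c) jg.
have mSv : measurable_fun setT Sv := measurable_sin_transform (measurable_phase c) jg.
have mU : measurable_fun setT (fun x => (Cu x ^+ 2 + Su x ^+ 2)%:E).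
  by apply/measurable_EFinP/measurable_funD; exact: measurable_funX.
have mV : measurable_fun setT (fun x => (Cv x ^+ 2 + Sv x ^+ 2)%:E).
  by apply/measurable_EFinP/measurable_funD; exact: measurable_funX.
have U0 x : (0 <= (Cu x ^+ 2 + Su x ^+ 2)%:E)%E by rewrite lee_fin addr_ge0 ?sqr_ge0.
have V0 x : (0 <= (Cv x ^+ 2 + Sv x ^+ 2)%:E)%E by rewrite lee_fin addr_ge0 ?sqr_ge0.
have key xi : normc (exp_transform c g xi) ^+ 2 <=
    2 * (Cu xi ^+ 2 + Su xi ^+ 2 + (Cv xi ^+ 2 + Sv xi ^+ 2)).
  by rewrite normc_sqrE exp_transformE//; exact: sum_sqr_le.
apply: (@le_trans _ _ (\int[area]_xi (2%:E * ((Cu xi ^+ 2 + Su xi ^+ 2)%:E +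
    (Cv xi ^+ 2 + Sv xi ^+ 2)%:E)))%E).
  apply: ge0_le_integral => //.
  - by move=> x _; rewrite lee_fin sqr_ge0.
  - apply/measurable_EFinP; apply: measurable_sqr_normc; exact: cmeasurable_exp_transform.
  - by apply: emeasurable_funM => //; exact: emeasurable_funD.
  by move=> xi _; rewrite -EFinD -EFinM lee_fin; exact: key.
rewrite ge0_integralZl//; last 2 first.
- exact: emeasurable_funD.
- by move=> x _; exact: adde_ge0.
rewrite EFinM -muleA lee_pmul2l//.
rewrite ge0_integralD//.
apply: (le_trans (leeD (bessel c0 rg) (bessel c0 jg))).
rewrite -ge0_muleDr; last 2 first.
- by apply: integral_ge0 => x _; rewrite lee_fin sqr_ge0.
- by apply: integral_ge0 => x _; rewrite lee_fin sqr_ge0.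
apply: lee_wpmul2l; first by rewrite lee_fin sqr_ge0.
rewrite -ge0_integralD//; last 4 first.
- by move=> x _; rewrite lee_fin sqr_ge0.
- by apply/measurable_EFinP; exact: measurable_funX.
- by move=> x _; rewrite lee_fin sqr_ge0.
- by apply/measurable_EFinP; exact: measurable_funX.
by under [leRHS]eq_integral do rewrite normc_sqrE.
Qed.

End ComplexTransform.

(** * Schwartz functions, supremum norms and convolution *)

Section SchwartzIntegrable.
Context {R : realType}.
Local Notation mu := (@lebesgue_measure R).

Lemma integrable_oneDsqrV : mu.-integrable setT (EFin \o (fun s : R => (1 + s ^+ 2)^-1)).
Proof.
apply/integrableP; split.
  apply/measurable_EFinP; apply: continuous_measurable_fun.
  exact: (@continuous_oneDsqrV R).
rewrite (_ : (\int[mu]_x _)%E = pi%:E) ?ltry// -integral_oneDsqr.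
apply: eq_integral => s _.
by rewrite /= ger0_norm// invr_ge0 addr_ge0// sqr_ge0.
Qed.

(** Combining the decay estimates with exponents 0 and 2 in each variable
bounds f by a multiple of 1 / ((1 + x1 ^ 2) * (1 + x2 ^ 2)). *)
Lemma schwartz_cintegrable (f : R * R -> R[i]) : schwartz f -> cintegrable f.
Proof.
move=> [sf decay]; have mf := smooth2_cmeasurable sf.
have fE x : cpartials [::] f x = f x by rewrite /cpartials /=; case: (f x).
have [M00 h00] := decay 0%N 0%N [::]; have [M20 h20] := decay 2%N 0%N [::].
have [M02 h02] := decay 0%N 2%N [::]; have [M22 h22] := decay 2%N 2%N [::].
pose M := M00 + M20 + M02 + M22.
pose h (x : plane R) := M * ((1 + x.1 ^+ 2)^-1 * (1 + x.2 ^+ 2)^-1).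
apply: (cintegrable_dominated (h := h)) => //.
  by have := integrableZl measurableT M (integrable_prodM integrable_oneDsqrV integrable_oneDsqrV);
    apply: eq_integrable.
move=> x; apply: le_trans (ler_norm _).
have d1 : 0 < 1 + x.1 ^+ 2 by rewrite ltr_pwDl// sqr_ge0.
have d2 : 0 < 1 + x.2 ^+ 2 by rewrite ltr_pwDl// sqr_ge0.
rewrite /h -invfM ler_pdivlMr ?mulr_gt0//.
move: (h00 x) (h20 x) (h02 x) (h22 x); rewrite fE !expr0 !mul1r !mulr1 normr1.
have n2 : `|x.1 ^+ 2| = x.1 ^+ 2 by rewrite ger0_norm// sqr_ge0.
have n4 : `|x.1 ^+ 2 * x.2 ^+ 2| = x.1 ^+ 2 * x.2 ^+ 2.
  by rewrite ger0_norm// mulr_ge0 ?sqr_ge0.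
have n3 : `|x.2 ^+ 2| = x.2 ^+ 2 by rewrite ger0_norm// sqr_ge0.
rewrite n2 n3 n4 => a1 a2 a3 a4.
have -> : normc (f x) * ((1 + x.1 ^+ 2) * (1 + x.2 ^+ 2)) =
  1 * normc (f x) + x.1 ^+ 2 * normc (f x) + x.2 ^+ 2 * normc (f x) +
  x.1 ^+ 2 * x.2 ^+ 2 * normc (f x) by ring.
by rewrite /M !lerD.
Qed.

End SchwartzIntegrable.

Section SupremumNorm.
Context {R : realType}.
Local Notation mu := (@lebesgue_measure R).

(** If g exceeded its essential supremum at x, it would do so on a ball around
x, which has positive measure. *)
Lemma continuous_le_ess_sup (g : R -> R) (x : R) : continuous g ->
  ((g x)%:E <= ess_sup mu (EFin \o g))%E.
Proof.
move=> cg; rewrite leNgt; apply/negP => lt.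
(* A real threshold is needed because the essential supremum may be -oo here. *)
have [a la ag] : exists2 a : R, (ess_sup mu (EFin \o g) <= a%:E)%E & a < g x.
  move: lt; case: (ess_sup _ _) => [r| |] //.
    by rewrite lte_fin => rx; exists r.
  by move=> _; exists (g x - 1); [rewrite leNye|rewrite ltrBlDr ltrDl].
have /nbhs_ballP[e /= e0 he] : \forall y \near x, a < g y.
  by have /cvgr_gt/(_ a ag) := cg x.
have := ess_sup_ge mu (EFin \o g) => -[A [mA A0 hA]].
have : (mu (ball x e) <= mu A)%E.
  apply: le_measure; rewrite ?inE//; first exact: measurable_ball.
  move=> y /he ay; apply: hA => /= /le_trans /(_ la).
  by rewrite lee_fin leNgt ay.
rewrite A0 lebesgue_measure_ball ?(ltW e0)// lee_fin leNgt.
by rewrite mulrn_wgt0.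
Qed.

(** For a continuous function the essential supremum bounds every value, and
compact support makes it finite. *)
Lemma sup_norm (Phi : R -> R[i]) : C0oo1 Phi -> exists S : R,
  [/\ 0 <= S, cLnorm mu +oo Phi = S%:E & forall s, normc (Phi s) <= S].
Proof.
move=> [sPhi cPhi]; have [rP jP] := smooth1_continuous sPhi.
have [B B0 hB] := compact_support_bounded rP jP cPhi.
pose g s := normc (Phi s).
have cg : continuous g.
  have -> : g = fun s => Num.sqrt (complex.Re (Phi s) ^+ 2 + complex.Im (Phi s) ^+ 2).
    by apply/funext => s; rewrite -normc_sqrE sqrtr_sqr ger0_norm// normc_ge0.
  move=> s; apply: continuous_comp; last exact: sqrt_continuous.
  by apply: cvgD; apply: cvgM; (exact: rP || exact: jP).
have NE : cLnorm mu +oo Phi = ess_sup mu (EFin \o g).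
  rewrite /cLnorm unlock ifT.
    by congr (ess_sup _ _); apply/funext => s /=; rewrite ger0_norm// normc_ge0.
  have := @lebesgue_measure_itv R `]-oo, +oo[; rewrite set_itvNyy /= => ->.
  by rewrite addye// ltry.
have le_sup s := @continuous_le_ess_sup g s cg.
have sup_le : (ess_sup mu (EFin \o g) <= B%:E)%E.
  by apply/ess_supP; apply: nearW => s; rewrite /= lee_fin; exact: hB.
move: NE le_sup sup_le; case: (ess_sup _ _) => [r| |] // NE le_sup _; last first.
  by have := le_sup 0.
have gr s : normc (Phi s) <= r by have := le_sup s; rewrite lee_fin.
by exists r; split => //; exact: le_trans (normc_ge0 _) (gr 0).
Qed.

End SupremumNorm.

Section Convolution.
Context {R : realType}.
Variables (phi f : plane R -> R[i]).
Hypotheses (iphi : cintegrable phi) (jf : cintegrable f).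
Local Notation fhat := (exp_transform (- (2 * pi)) f).

(** Up to dilation, the Fourier transform of the convolution of f with the
kernel at scale t; the scale sits on the side of f, so that the multiplier
keeps its fixed compact support. *)
Definition frequency_piece (t : R) (xi : plane R) : R[i] :=
  phi xi * fhat (t^-1 * xi.1, t^-1 * xi.2).

Lemma cintegrable_frequency_piece t : cintegrable (frequency_piece t).
Proof.
have [B B0 hB] := exp_transform_bounded (- (2 * pi)) jf.
have iB := integrableZl measurableT B (cintegrable_normc iphi).
apply: (cintegrable_dominated (h := fun xi => B * normc (phi xi))).
- apply: cmeasurableM; first exact: cintegrable_cmeasurable.
  apply: (cmeasurable_comp (cmeasurable_exp_transform _ jf)).
  by apply: measurable_fun_pair; apply: measurable_funM.
- by apply: eq_integrable iB.
- move=> xi; rewrite ComplexField.Normc.normcM ger0_norm ?mulr_ge0 ?normc_ge0//.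
  by rewrite mulrC ler_wpM2r ?normc_ge0.
Qed.

(** Write the kernel as an integral over frequencies and exchange it with the
integral over y, which produces the Fourier transform of f at xi / t. *)
Lemma convolution_dilateE t x : 0 < t ->
  convolution (dilate (inv_fourier phi) t) f x =
  (t ^- 2)%:C * exp_transform (2 * pi / t) (frequency_piece t) x.
Proof.
move=> t0; set a : R[i] := (t ^- 2)%:C.
have mphi := cintegrable_cmeasurable iphi; have mf := cintegrable_cmeasurable jf.
pose G (p : plane R * plane R) : R[i] := (a * f p.1) *
  (phi p.2 * expi (2 * pi * dot (t^-1 *: (x - p.1)) p.2)).
have mG : cmeasurable G.
  apply: cmeasurableM; first apply: cmeasurableM.
  - by split => //=.
  - exact: (cmeasurable_comp mf).
  apply: cmeasurableM; first exact: (cmeasurable_comp mphi).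
  apply: cmeasurable_expi; apply: measurable_funM => //.
  apply: measurable_funD; apply: measurable_funM.
  - apply: measurable_funM => //; apply: measurable_funB => //.
    by apply: measurableT_comp.
  - by apply: measurableT_comp.
  - apply: measurable_funM => //; apply: measurable_funB => //.
    by apply: measurableT_comp.
  - by apply: measurableT_comp.
have dG y xi : normc (G (y, xi)) <= `|normc a * normc (f y)| * `|normc (phi xi)|.
  rewrite /G !ComplexField.Normc.normcM normc_expi mulr1.
  by rewrite (ger0_norm (mulr_ge0 (normc_ge0 _) (normc_ge0 _))) ger0_norm ?normc_ge0.
have ial : area.-integrable setT (EFin \o (fun y => normc a * normc (f y))).
  by have := integrableZl measurableT (normc a) (cintegrable_normc jf); apply: eq_integrable.
transitivity (cintegral2 (fun y => cintegral2 (fun xi => G (y, xi)))).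
  apply: eq_cintegral2 => y; rewrite /G /= cintegral2Zl; last first.
    rewrite (_ : (fun xi => _) =
      (fun xi => phi xi * expi (2 * pi * dot xi (t^-1 *: (x - y))))).
      exact: cintegrable_exp.
    by apply/funext => xi; rewrite /dot (mulrC xi.1) (mulrC xi.2).
  rewrite /dilate -/a /inv_fourier; ring.
rewrite (cintegral2_swap mG ial (cintegrable_normc iphi) dG).
rewrite /exp_transform -cintegral2Zl; last first.
  exact/cintegrable_exp/cintegrable_frequency_piece.
apply: eq_cintegral2 => xi.
rewrite /frequency_piece /exp_transform.
transitivity ((a * (phi xi * expi (2 * pi / t * dot xi x))) *
    cintegral2 (fun y => f y * expi (- (2 * pi) * dot y (t^-1 * xi.1, t^-1 * xi.2)))); last by ring.
rewrite -cintegral2Zl; last exact: cintegrable_exp.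
apply: eq_cintegral2 => y; rewrite /G /=.
have -> : 2 * pi * dot (t^-1 *: (x - y)) xi =
    2 * pi / t * dot xi x + - (2 * pi) * dot y (t^-1 * xi.1, t^-1 * xi.2).
  have e1 : (t^-1 *: (x - y)).1 = t^-1 * (x.1 - y.1) by [].
  have e2 : (t^-1 *: (x - y)).2 = t^-1 * (x.2 - y.2) by [].
  by rewrite /dot e1 e2 /=; ring.
by rewrite expiD; ring.
Qed.

(** For t > 0 the formula in frequency expresses the convolution as an
integral of a jointly measurable function depending on the parameters t and x.
*)
Lemma measurable_square_integrand :
  measurable_fun setT (fun p : measurableTypeR R * plane R =>
    if 0 < p.1 then normc (convolution (dilate (inv_fourier phi) p.1) f p.2) ^+ 2 / p.1 else 0).
Proof.
have mphi := cintegrable_cmeasurable iphi.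
pose G (z : (measurableTypeR R * plane R) * plane R) : R[i] :=
  frequency_piece z.1.1 z.2 * expi (2 * pi / z.1.1 * dot z.2 z.1.2).
have minv : measurable_fun setT (fun z : (measurableTypeR R * plane R) * plane R => z.1.1^-1).
  apply: (measurableT_comp (@measurable_invr R)).
  by apply: (measurableT_comp (f := fst)).
have m11 : measurable_fun setT (fun z : (measurableTypeR R * plane R) * plane R => z.1.1).
  by apply: measurableT_comp.
have m12 : measurable_fun setT (fun z : (measurableTypeR R * plane R) * plane R => z.1.2).
  by apply: measurableT_comp.
have mG : cmeasurable G.
  apply: cmeasurableM; first apply: cmeasurableM.
  - exact: (cmeasurable_comp mphi).
  - apply: (cmeasurable_comp (cmeasurable_exp_transform _ jf)).
    by apply: measurable_fun_pair; apply: measurable_funM => //; apply: measurableT_comp.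
  - apply: cmeasurable_expi; apply: measurable_funM; first exact: measurable_funM.
    by apply: measurable_funD; apply: measurable_funM; apply: measurableT_comp => //;
      apply: measurableT_comp.
pose E (p : measurableTypeR R * plane R) : R[i] := cintegral2 (fun xi => G (p, xi)).
have mE : cmeasurable E.
  split.
  - exact: (@measurable_Rintegral_param _ _ (measurableTypeR R * plane R)%type (plane R) R
      area (fun z => complex.Re (G z)) mG.1).
  - exact: (@measurable_Rintegral_param _ _ (measurableTypeR R * plane R)%type (plane R) R
      area (fun z => complex.Im (G z)) mG.2).
have pieceE t x : 0 < t ->
    normc (convolution (dilate (inv_fourier phi) t) f x) ^+ 2 / t =
    t^-1 ^+ 4 * normc (E (t, x)) ^+ 2 * t^-1.
  move=> t0; rewrite convolution_dilateE// ComplexField.Normc.normcM exprMn.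
  have -> : normc ((t ^- 2)%:C : R[i]) ^+ 2 = t^-1 ^+ 4.
    by rewrite normc_sqrE /= expr0n addr0 -exprVn -exprM.
  by [].
rewrite (_ : (fun p => _) = (fun p : measurableTypeR R * plane R =>
  if 0 < p.1 then p.1^-1 ^+ 4 * normc (E p) ^+ 2 * p.1^-1 else 0)); last first.
  by apply/funext => -[t x]; case: ifPn => // t0; exact: pieceE.
have mp1 : measurable_fun setT (fun p : measurableTypeR R * plane R => p.1^-1).
  by apply: (measurableT_comp (@measurable_invr R)).
apply: measurable_fun_if => //.
- apply: (measurable_fun_bool true) => //=; rewrite setTI.
  rewrite (_ : _ @^-1` _ = `]0, +oo[%classic `*` setT).
    by apply: measurableX => //; exact: measurable_itv.
  apply/seteqP; split => -[t x] /=; rewrite in_itv/= andbT; first by [].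
  by case.
- apply: measurable_funTS; apply: measurable_funM => //.
  apply: measurable_funM; first exact: measurable_funX.
  exact: measurable_sqr_normc.
Qed.

End Convolution.

(** * The square function in frequency *)

Section SquareFunction.
Context {R : realType}.
Local Notation mu := (@lebesgue_measure R).
Variables (phi f : plane R -> R[i]) (A : R).
Hypotheses (iphi : cintegrable phi) (jf : cintegrable f) (A0 : 0 <= A).
Hypothesis phiA : forall w : plane R, (\int[mu]_(t in `]0%R, +oo[)
  (normc (phi (t * w.1, t * w.2)) ^+ 2 / t)%:E <= A%:E)%E.
Local Notation fhat := (exp_transform (- (2 * pi)) f).
Local Notation conv t x := (convolution (dilate (inv_fourier phi) t) f x).

Let pi0 : pi != 0 :> R.
Proof. by rewrite gt_eqF// pi_gt0. Qed.

Let mphi2 : measurable_fun setT (fun x => normc (phi x) ^+ 2).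
Proof. by apply: measurable_sqr_normc; exact: cintegrable_cmeasurable. Qed.

Let mfhat2 : measurable_fun setT (fun x => normc (fhat x) ^+ 2).
Proof. by apply: measurable_sqr_normc; exact: cmeasurable_exp_transform. Qed.

(** The factors of t balance: t ^- 4 from the dilated kernel, t ^+ 2 from the
L2 bound at frequency 2 * pi / t, and t ^+ 2 from the change of variables xi =
t * w. *)
Let energy_at_scale t : 0 < t ->
  (\int[area]_x (normc (conv t x) ^+ 2 / t)%:E <=
   128%:E * \int[area]_w (normc (phi (t * w.1, t * w.2)) ^+ 2 / t * normc (fhat w) ^+ 2)%:E)%E.
Proof.
move=> t0; have tn0 : t != 0 by rewrite gt_eqF.
pose g := frequency_piece phi f t.
have ig : cintegrable g by exact: cintegrable_frequency_piece.
have c0 : 2 * pi / t != 0 by rewrite !mulf_neq0 ?invr_eq0.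
have mTg : measurable_fun setT (fun x => (normc (exp_transform (2 * pi / t) g x) ^+ 2)%:E).
  by apply/measurable_EFinP; apply: measurable_sqr_normc; exact: cmeasurable_exp_transform.
have mg : measurable_fun setT (fun x => (normc (g x) ^+ 2)%:E).
  by apply/measurable_EFinP; apply: measurable_sqr_normc; exact: cintegrable_cmeasurable.
have t5 : 0 <= t ^- 5 by rewrite invr_ge0 exprn_ge0// ltW.
have -> : (\int[area]_x (normc (conv t x) ^+ 2 / t)%:E = (t ^- 5)%:E *
    \int[area]_x (normc (exp_transform (2 * pi / t) g x) ^+ 2)%:E)%E.
  rewrite -ge0_integralZl//; last by move=> x _; rewrite lee_fin sqr_ge0.
  apply: eq_integral => x _; rewrite -EFinM; congr EFin.
  rewrite convolution_dilateE// ComplexField.Normc.normcM exprMn.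
  have -> : normc ((t ^- 2)%:C : R[i]) ^+ 2 = t ^- 4.
    by rewrite normc_sqrE /= expr0n addr0 -exprVn -exprM exprVn.
  by rewrite /g; field.
apply: (le_trans (lee_wpmul2l _ (cbessel c0 ig))); first by rewrite lee_fin.
rewrite muleA -EFinM.
rewrite (area_dilation t0 mg); last by move=> x; rewrite lee_fin sqr_ge0.
pose I w := normc (phi (t * w.1, t * w.2)) ^+ 2 * normc (fhat w) ^+ 2.
have mtw : measurable_fun setT (fun w : plane R => (t * w.1, t * w.2) : plane R).
  by apply: measurable_fun_pair; apply: measurable_funM.
have mI : measurable_fun setT I.
  by apply: measurable_funM => //; exact: (measurableT_comp mphi2 mtw).
have I0 w : 0 <= I w by rewrite mulr_ge0 ?sqr_ge0.
have -> : (\int[area]_x (normc (g (t * x.1, t * x.2)%R) ^+ 2)%:E = \int[area]_w (I w)%:E)%E.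
  apply: eq_integral => w _; congr EFin.
  rewrite /g /frequency_piece /= !mulKf// -surjective_pairing.
  by rewrite ComplexField.Normc.normcM exprMn.
have -> : (\int[area]_w (normc (phi (t * w.1, t * w.2)%R) ^+ 2 / t * normc (fhat w) ^+ 2)%:E =
    (t^-1)%:E * \int[area]_w (I w)%:E)%E.
  rewrite -ge0_integralZl//.
  - by apply: eq_integral => w _; rewrite -EFinM; congr EFin; rewrite /I; ring.
  - exact/measurable_EFinP.
  - by move=> w _; rewrite lee_fin.
  - by rewrite ?lee_fin invr_ge0 ltW.
rewrite !muleA -!EFinM le_eqVlt; apply/orP; left; apply/eqP; congr (_%:E * _)%E.
rewrite normf_div normrM (gtr0_norm t0) (gtr0_norm (pi_gt0 R)) ger0_norm//.
by move: (@pi R) pi0 => P P0; field; rewrite tn0 P0.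
Qed.

(** Exchange the integrals in t and x, apply energy_at_scale, and exchange
back: the integral in t now sees only the multiplier along the ray through w.
The last step is the L2 bound for the Fourier transform of f. *)
Lemma square_function_bound :
  (\int[area]_x \int[mu]_(t in `]0%R, +oo[) (normc (conv t x) ^+ 2 / t)%:E
   <= (128 ^+ 2 * A)%:E * \int[area]_x (normc (f x) ^+ 2)%:E)%E.
Proof.
pose Q (z : measurableTypeR R * plane R) : \bar R :=
  (if 0 < z.1 then normc (conv z.1 z.2) ^+ 2 / z.1 else 0)%:E.
have mQ : measurable_fun setT Q.
  by apply/measurable_EFinP; exact: measurable_square_integrand.
have Q0 z : (0 <= Q z)%E.
  by rewrite lee_fin; case: ifPn => // t0; rewrite divr_ge0 ?sqr_ge0 ?ltW.
pose P (z : measurableTypeR R * plane R) : \bar R :=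
  (if 0 < z.1 then normc (phi (z.1 * z.2.1, z.1 * z.2.2)) ^+ 2 / z.1 * normc (fhat z.2) ^+ 2
   else 0)%:E.
have minv : measurable_fun setT (fun z : measurableTypeR R * plane R => z.1^-1).
  by apply: (measurableT_comp (@measurable_invr R)).
have mP : measurable_fun setT P.
  apply/measurable_EFinP; apply: measurable_fun_if => //.
  - apply: (measurable_fun_bool true) => //=; rewrite setTI.
    rewrite (_ : _ @^-1` _ = `]0, +oo[%classic `*` setT).
      by apply: measurableX => //; exact: measurable_itv.
    apply/seteqP; split => -[t x] /=; rewrite in_itv/= andbT; first by [].
    by case.
  - apply: measurable_funTS; apply: measurable_funM; last by apply: (measurableT_comp mfhat2).
    apply: measurable_funM => //; apply: (measurableT_comp mphi2).
    apply: measurable_fun_pair; apply: measurable_funM => //;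
      by apply: measurableT_comp => //; apply: measurableT_comp.
have P0 z : (0 <= P z)%E.
  rewrite lee_fin; case: ifPn => // t0.
  by rewrite mulr_ge0 ?sqr_ge0// divr_ge0 ?sqr_ge0 ?ltW.
have -> : (\int[area]_x \int[mu]_(t in `]0%R, +oo[) (normc (conv t x) ^+ 2 / t)%:E =
    \int[area]_x \int[mu]_t Q (t, x))%E.
  apply: eq_integral => x _; rewrite integral_mkcond; apply: eq_integral => t _.
  by rewrite /Q patchE mem_setE in_itv/= andbT; case: ifP.
rewrite -(@fubini_tonelli _ _ _ _ _ mu area Q mQ Q0).
apply: (@le_trans _ _ (\int[mu]_t (128%:E * \int[area]_w P (t, w)))%E).
  apply: ge0_le_integral => //.
  - by move=> t _; exact: integral_ge0.
  - exact: (@measurable_fun_fubini_tonelli_F _ _ _ _ _ area Q).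
  - apply: emeasurable_funM => //.
    exact: (@measurable_fun_fubini_tonelli_F _ _ _ _ _ area P).
  move=> t _; have [t0|t0] := ltP 0 t.
    have -> : (\int[area]_x Q (t, x) = \int[area]_x (normc (conv t x) ^+ 2 / t)%:E)%E.
      by apply: eq_integral => x _; rewrite /Q ifT.
    apply: (le_trans (energy_at_scale t0)); rewrite le_eqVlt; apply/orP; left.
    by apply/eqP; congr (_ * _)%E; apply: eq_integral => w _; rewrite /P ifT.
  have -> : (\int[area]_x Q (t, x) = 0)%E.
    by apply: integral0_eq => x _; rewrite /Q ifF// ltNge t0.
  by rewrite mule_ge0//; exact: integral_ge0.
rewrite ge0_integralZl//; last 2 first.
- exact: (@measurable_fun_fubini_tonelli_F _ _ _ _ _ area P).
- by move=> t _; exact: integral_ge0.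
rewrite (@fubini_tonelli _ _ _ _ _ mu area P mP P0).
apply: (@le_trans _ _ (128%:E * \int[area]_w (A%:E * (normc (fhat w) ^+ 2)%:E))%E).
  rewrite lee_wpmul2l//; apply: ge0_le_integral => //.
  - by move=> w _; exact: integral_ge0.
  - exact: (@measurable_fun_fubini_tonelli_G _ _ _ _ _ mu P).
  - by apply: emeasurable_funM => //; exact/measurable_EFinP.
  move=> w _.
  have -> : (\int[mu]_t P (t, w) = \int[mu]_(t in `]0%R, +oo[)
     ((normc (phi (t * w.1, t * w.2)) ^+ 2 / t)%:E * (normc (fhat w) ^+ 2)%:E))%E.
    rewrite [RHS]integral_mkcond; apply: eq_integral => t _.
    by rewrite /P patchE mem_setE in_itv/= andbT; case: ifP.
  rewrite ge0_integralZr//; last 3 first.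
  - apply/measurable_EFinP; apply: measurable_funTS; apply: measurable_funM.
      apply: (measurableT_comp mphi2).
      by apply: measurable_fun_pair; apply: measurable_funM.
    exact: measurable_invr.
  - move=> t; rewrite /= in_itv/= andbT => t0.
    by rewrite lee_fin divr_ge0 ?sqr_ge0 ?ltW.
  - by rewrite lee_fin sqr_ge0.
  by rewrite lee_wpmul2r ?lee_fin ?sqr_ge0.
rewrite ge0_integralZl//; last 2 first.
- exact/measurable_EFinP.
- by move=> w _; rewrite lee_fin sqr_ge0.
have c0 : - (2 * pi) != 0 :> R by rewrite oppr_eq0 mulf_neq0.
have e8 : 2 * (16 * pi / `|- (2 * pi)|) ^+ 2 = 128 :> R.
  rewrite normrN normrM (gtr0_norm (pi_gt0 R)) ger0_norm//.
  by move: (@pi R) pi0 => P' P0'; field.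
apply: (@le_trans _ _ (128%:E * (A%:E * (128%:E * \int[area]_x (normc (f x) ^+ 2)%:E)))%E).
  do 2 (apply: lee_wpmul2l; first by rewrite lee_fin).
  by have := cbessel c0 jf; rewrite e8.
by rewrite !muleA -!EFinM le_eqVlt; apply/orP; left; apply/eqP; congr (_%:E * _)%E; ring.
Qed.

End SquareFunction.

(** * The Littlewood-Paley estimate *)

Section MultiplierIntegrable.
Context {R : realType}.
Variables (p q : R) (psi : R -> R) (b : R * R -> R[i]).
Hypothesis psi_smooth : smooth_within `[p, q] psi.
Hypotheses (b_C0oo : C0oo2 b) (b_supp : supp b `<=` interior `[p, q] `*` [set: R]).
Hypothesis b_near0 : \forall xi \near (0 : R * R), b xi = 0.

(** The multiplier is bounded and vanishes outside a square. *)
Lemma phi_cintegrable (Phi : R -> R[i]) (delta S : R) : smooth1 Phi ->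
  (forall s, normc (Phi s) <= S) -> cintegrable (phi_delta b Phi psi delta).
Proof.
move=> sPhi PhiS.
have [B B0 bB] := b_bounded b_C0oo.
have [r [M [_ M0 brM]]] := b_annulus b_C0oo b_near0.
have S0 : 0 <= S by exact: le_trans (normc_ge0 _) (PhiS 0).
pose h (xi : plane R) := B * S * (\1_(`[- M, M]) xi.1 * \1_(`[- M, M]) xi.2).
apply: (cintegrable_dominated (h := h)).
- exact: (phi_cmeasurable psi_smooth b_C0oo b_supp).
- have i1 := @integrable_indic_itv R (- M) M true false.
  by have := integrableZl measurableT (B * S) (integrable_prodM i1 i1); apply: eq_integrable.
move=> xi; rewrite /phi_delta ComplexField.Normc.normcM.
have [->|bxi] := eqVneq (b xi) 0; first by rewrite ComplexField.Normc.normc0 mul0r.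
have /andP[_ xiM] := brM _ bxi.
have x1 : xi.1 \in `[- M, M]%classic.
  rewrite inE/= in_itv/= -ler_norml; apply: le_trans xiM.
  by rewrite prod_normE le_max lexx.
have x2 : xi.2 \in `[- M, M]%classic.
  rewrite inE/= in_itv/= -ler_norml; apply: le_trans xiM.
  by rewrite prod_normE le_max lexx orbT.
rewrite /h !indicE x1 x2 !mulr1 ger0_norm ?mulr_ge0//.
by rewrite ler_pM ?normc_ge0.
Qed.

End MultiplierIntegrable.

Lemma poweR_half_sqrM (R : realType) (c : R) (I : \bar R) : 0 <= c -> (0 <= I)%E ->
  (((c ^+ 2)%:E * I) `^ 2^-1 = c%:E * I `^ 2^-1)%E.
Proof.
move=> c0 I0; rewrite poweRM ?lee_fin ?sqr_ge0//; congr (_ * _)%E.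
by rewrite poweR_EFin powR12_sqrt ?sqr_ge0// sqrtr_sqr ger0_norm.
Qed.

Lemma cLnorm2E (R : realType) (f : plane R -> R[i]) :
  cLnorm (leb2 R) 2%:E f =
  ((\int[area]_x (normc (f x) ^+ 2)%:E) `^ 2^-1)%E.
Proof.
rewrite /cLnorm unlock; congr (_ `^ _)%E; apply: eq_integral => x _.
by rewrite abse_EFin poweR_EFin powR_mulrn ?normr_ge0// ger0_norm ?normc_ge0.
Qed.

Lemma Lnorm2_LP_functionE (R : realType) (h f : plane R -> R[i]) :
  ('N[leb2 R]_2%:E[LP_function h f] =
  (\int[area]_x \int[lebesgue_measure]_(t in `]0%R, +oo[)
     (normc (convolution (dilate h t) f x) ^+ 2 / t)%:E) `^ 2^-1)%E.
Proof.
rewrite unlock; congr (_ `^ _)%E; apply: eq_integral => x _.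
rewrite gee0_abs ?poweR_ge0// /LP_function -poweRrM mulVf// poweRe1//.
apply: integral_ge0 => t /=; rewrite in_itv/= andbT => t0.
by rewrite lee_fin divr_ge0 ?sqr_ge0 ?ltW.
Qed.

Theorem theorem1p5 (R : realType) (p q : R) (psi : R -> R) (b : R * R -> R[i])
    (ltpq : p < q)
    (psi_smooth : smooth_within `[p, q] psi)
    (psi_neq0 : forall t : R, `[p, q]%classic t ->
       psi t - t * derive_within `[p, q] psi t != 0)
    (b_C0oo : C0oo2 b)
    (b_supp : supp b `<=` interior `[p, q] `*` [set: R])
    (b_near0 : \forall xi \near (0 : R * R), b xi = 0) :
  exists C : R,
    forall (Phi : R -> R[i]) (delta : R) (f : R * R -> R[i]),
      C0oo1 Phi -> supp Phi `<=` `[-1, 1] ->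
      0 < delta <= 2^-1 ->
      schwartz f ->
      let eta := inv_fourier (phi_delta b Phi psi delta) in
      ('N[leb2 R]_2%:E[LP_function eta f]
       <= (C * delta `^ 2^-1)%:E * cLnorm lebesgue_measure +oo Phi
          * cLnorm (leb2 R) 2%:E f)%E.
Proof.
have [K K0 hK] := multiplier_bound ltpq psi_smooth psi_neq0 b_C0oo b_supp b_near0.
(* On squares of norms, each of the two uses of the L2 bound costs
   2 * (16 * pi / (2 * pi)) ^ 2 = 128. *)
exists (128 * Num.sqrt K).
move=> Phi delta f Phi_C0oo Phi_supp /andP[delta0 _] sf; cbv zeta.
have [S [S0 SE PhiS]] := sup_norm Phi_C0oo.
have iphi := phi_cintegrable psi_smooth b_C0oo b_supp b_near0 delta Phi_C0oo.1 PhiS.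
have jf := schwartz_cintegrable sf.
have A0 : 0 <= K * (delta * S ^+ 2) by rewrite !mulr_ge0 ?sqr_ge0// ltW.
have bound := square_function_bound iphi jf A0 (hK _ _ _ Phi_C0oo.1 Phi_supp delta0 PhiS).
rewrite Lnorm2_LP_functionE cLnorm2E SE -EFinM.
have I0 : (0 <= \int[area]_x (normc (f x) ^+ 2)%:E)%E.
  by apply: integral_ge0 => x _; rewrite lee_fin sqr_ge0.
rewrite -poweR_half_sqrM//; last by rewrite !mulr_ge0 ?sqrtr_ge0 ?powR_ge0.
apply: gt0_ler_poweR; rewrite ?invr_ge0//.
- rewrite in_itv/= leey andbT; apply: integral_ge0 => x _; apply: integral_ge0 => t /=.
  by rewrite in_itv/= andbT => t0; rewrite lee_fin divr_ge0 ?sqr_ge0 ?ltW.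
- by rewrite in_itv/= leey andbT mule_ge0// lee_fin sqr_ge0.
apply: (le_trans bound); rewrite le_eqVlt; apply/orP; left; apply/eqP.
congr (_%:E * _)%E.
rewrite powR12_sqrt ?(ltW delta0)// !exprMn !sqr_sqrtr ?(ltW delta0)//.
by ring.
Qed.
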